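(* Let $\varepsilon>0$. For every $\psi:\mathbb{N}\to\mathbb{R}_{\geq0}$ and $y\in\mathbb{R}$, \[ |\mathcal{A}^{y}_{2,1}(\psi)|=1\quad\text{if}\quad \sum_{q=1}^\infty\Bigl(\frac{\varphi(q)}{q}\Bigr)^{1+\varepsilon}q\,\psi(q)=\infty . \] For every $\psi:\mathbb{N}\to\mathbb{R}_{\geq0}$ and $\mathbf{y}\in\mathbb{R}^2$, \[ |\mathcal{A}^{\mathbf{y}}_{1,2}(\psi)|=1\quad\text{if}\quad \sum_{q=1}^\infty\Bigl(\frac{\varphi(q)}{q}\Bigr)^{1+\varepsilon}\psi(q)^2=\infty . \]
   Context: $\varphi$ is Euler's totient function. For $\mathbf{q}\in\mathbb{Z}^n$, $|\mathbf{q}|=\max_i|q_i|$; points $\mathbf{x}\in[0,1]^{nm}$ are $n\times m$ matrices and $\mathbf{q}\mathbf{x}$ is the row-vector–matrix product. $\mathcal{A}^{\mathbf{y}}_{n,m}(\psi)$ is the set of $\mathbf{x}\in[0,1]^{nm}$ such that for infinitely many $(\mathbf{p},\mathbf{q})\in\mathbb{Z}^m\times(\mathbb{Z}^n\setminus\{\mathbf0\})$, $\mathbf{q}\mathbf{x}+\mathbf{p}$ lies in the max-norm ball in $\mathbb{R}^m/\mathbb{Z}^m$ of centre $\mathbf{y}$ and radius $\psi(|\mathbf{q}|)$. $|\cdot|$ denotes Lebesgue measure. *)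

(* Defs.v *)
From HB Require Import structures.
From mathcomp Require Import all_boot all_order all_algebra.
From mathcomp Require Import all_classical all_reals all_analysis.
Import Order.TTheory GRing.Theory Num.Theory.
Set Implicit Arguments.
Unset Strict Implicit.
Unset Printing Implicit Defensive.
Local Open Scope ring_scope.
Local Open Scope classical_set_scope.

(* A^y_{2,1}(psi): x is a 2x1 matrix (x.1; x.2), q = (q1,q2) in Z^2 \ {0},
   p in Z, and |q1 x.1 + q2 x.2 + p - y| < psi(max(|q1|,|q2|)) for
   infinitely many (p,q). Pairs are encoded as (p, (q1, q2)). *)
Definition A21 (R : realType) (psi : nat -> R) (y : R) : set (R * R) :=
  [set x | (0 <= x.1 <= 1) /\ (0 <= x.2 <= 1) /\
    infinite_set [set pq : int * (int * int) |
      pq.2 != (0%Z, 0%Z) /\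
      `| pq.2.1%:~R * x.1 + pq.2.2%:~R * x.2 + pq.1%:~R - y |
        < psi (maxn `|pq.2.1|%N `|pq.2.2|%N)]].

(* A^y_{1,2}(psi): x is a 1x2 matrix (x.1, x.2), q in Z \ {0},
   p = (p1,p2) in Z^2, and max_i |q x_i + p_i - y_i| < psi(|q|) for
   infinitely many (p,q). Pairs are encoded as ((p1, p2), q). *)
Definition A12 (R : realType) (psi : nat -> R) (y : R * R) : set (R * R) :=
  [set x | (0 <= x.1 <= 1) /\ (0 <= x.2 <= 1) /\
    infinite_set [set pq : (int * int) * int |
      pq.2 != 0%Z /\
      Num.max `| pq.2%:~R * x.1 + pq.1.1%:~R - y.1 |
              `| pq.2%:~R * x.2 + pq.1.2%:~R - y.2 |
        < psi `|pq.2|%N]].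

(* Main.v *)
Require Import Defs.
From HB Require Import structures.
From mathcomp Require Import all_boot all_order all_algebra cyclic.
From mathcomp Require Import all_classical all_reals all_analysis.
From mathcomp Require Import measurable_realfun.
From mathcomp Require Import zify ring lra.
Import Order.TTheory GRing.Theory Num.Theory.
Local Open Scope ring_scope.
Local Open Scope classical_set_scope.

(** Write [w n = totient n / n], which dominates [(totient n / n) `^ (1 + eps)], and let
    [E n] be the sets in question, of measure [|E n|] and truncated so that their radius is
    at most [1].  A set [A] invariant under the translations by [i s / M] is compared with a
    strip [{frac (l x) < d}] by averaging over these translations; this is a count of
    fractional parts, with error governed by [gcdn c M] where [c = l s].  It gives
    [w n w k |E n /\ E k| <= 2 M n M k + 2 M n w k gcdn n k ^ 2 / n ^ 2], with
    [M n = w n |E n|] and [k <= n], and the identity [sum_(d | n) totient d = n] yields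
    [sum_(k <= n) w k gcdn n k ^ 2 <= n ^ 2].  Hence the functions
    [f N = (sum_(n < N) w n \1_(E n)) / (sum_(n < N) M n)] are bounded in L^2.

    No zero-one law is needed to pass to full measure: the [f N] converge to [1] against
    indicators of rectangles, hence, by L^2-boundedness and a Dynkin argument, against
    indicators of all measurable sets [F].  If all but finitely many [E n] miss [F], the
    integral of [f N] over [F] tends to [0], so that [F] is null.

    For 2 x 1 matrices only the vectors [q = (j, n)] with [0 <= j < n] are used: non-parallel
    ones give independent sets, and there are at most [gcdn n k] parallel pairs. *)

(** * Counting fractional parts *)

Definition frac {R : realType} (t : R) : R := t - (Num.floor t)%:~R.

Lemma frac_ge0 (R : realType) (t : R) : 0 <= frac t.
Proof. by rewrite subr_ge0 floor_le. Qed.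

Lemma frac_lt1 (R : realType) (t : R) : frac t < 1.
Proof. by rewrite ltrBlDl -[1]/(1%:~R) -intrD floorD1_gt. Qed.

Lemma frac_def (R : realType) (t : R) (m : int) :
  m%:~R <= t < m%:~R + 1 -> frac t = t - m%:~R.
Proof. by move=> h; rewrite /frac (@floor_def _ _ m) // intrD. Qed.

Lemma frac_id (R : realType) (t : R) : 0 <= t < 1 -> frac t = t.
Proof. by move=> h; rewrite (@frac_def _ _ 0) ?subr0 // add0r. Qed.

Lemma fracDz (R : realType) (t : R) (m : int) : frac (t + m%:~R) = frac t.
Proof. by rewrite /frac floorDrz ?intr_int // intrKfloor intrD; ring. Qed.

Lemma fracDn (R : realType) (t : R) (m : nat) : frac (t + m%:R) = frac t.
Proof. exact: (fracDz _ t m%:Z). Qed.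

Lemma fracD_frac (R : realType) (s t : R) : frac (s + frac t) = frac (s + t).
Proof. by rewrite [X in frac (_ + X)]/frac addrA -mulrNz fracDz. Qed.

Lemma floorDz (R : realType) (t : R) (m : int) :
  Num.floor (t + m%:~R) = Num.floor t + m.
Proof. by rewrite floorDrz ?intr_int // intrKfloor. Qed.

(** Moving back from [t] by [d <= 1] lowers the floor by at most one, and lowers it exactly when
    [frac t < d]. Indicators thus become differences of floors, which Hermite's identity can sum. *)
Lemma frac_lt_floor (R : realType) (d t : R) : 0 <= d <= 1 ->
  ((frac t < d)%R%:R : R) = (Num.floor t)%:~R - (Num.floor (t - d))%:~R.
Proof.
move=> /andP[d0 d1]; have := frac_ge0 _ t; have := frac_lt1 _ t.
rewrite /frac; set m := Num.floor t => lt1 ge0.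
case: ltP => h.
  have mE : (m - 1)%:~R = m%:~R - 1 :> R by rewrite rmorphB.
  rewrite (@floor_def _ (t - d) (m - 1)) ?subrK mE; first by rewrite subKr.
  by apply/andP; split; lra.
rewrite (@floor_def _ (t - d) m) ?subrr // intrD /=.
by apply/andP; split; lra.
Qed.

(* Hermite's identity *)
Lemma sum_floor (R : realType) (t : R) (K : nat) : (0 < K)%N ->
  \sum_(j < K) Num.floor (t + j%:R / K%:R) = Num.floor (K%:R * t).
Proof.
move=> K0; have K0r : (0 : R) < K%:R by rewrite ltr0n.
(* Replacing [s] by [s + 1 / K] shifts the list of arguments by one place: the term at [s] leaves
   and the term at [s + 1] enters. *)
have step (s : R) : \sum_(j < K) Num.floor (s + K%:R^-1 + j%:R / K%:R) =
    \sum_(j < K) Num.floor (s + j%:R / K%:R) + 1.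
  case: K K0 K0r => // K _ K0r.
  rewrite big_ord_recr [X in _ = X + 1]big_ord_recl /= mul0r addr0.
  have -> : s + K.+1%:R^-1 + K%:R / K.+1%:R = s + 1%:~R.
    have {}K0r : (K%:R + 1 : R) != 0 by rewrite natr1 lt0r_neq0.
    by rewrite -natr1; field.
  rewrite floorDz addrA; congr (_ + _); rewrite addrC; congr (_ + _).
  apply: eq_bigr => i _; congr (Num.floor _).
  by rewrite /= /bump /= add1n -(nat1r i) mulrDl mul1r addrA.
have shift (m : int) (s : R) :
    \sum_(j < K) Num.floor (s + m%:~R / K%:R + j%:R / K%:R) =
    \sum_(j < K) Num.floor (s + j%:R / K%:R) + m.
  elim: m s => [|m IH|m IH] s.
  - by rewrite mul0r !addr0.
  - rewrite -addn1 PoszD rmorphD/= mulrDl mul1r addrA step IH.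
    by rewrite -addrA.
  - have := step (s + (- (m.+1)%:Z)%:~R / K%:R).
    have -> : s + (- m.+1%:Z)%:~R / K%:R + K%:R^-1 = s + (- m%:Z)%:~R / K%:R.
      by rewrite -addn1 PoszD opprD rmorphD/= mulrDl mulN1r addrA subrK.
    rewrite IH => /eqP; rewrite addrC -subr_eq => /eqP <-.
    by rewrite -addn1 PoszD opprD; lia.
set m := Num.floor (K%:R * t).
(* Subtracting [m / K] reduces to [0 <= K t < 1], where every argument lies in [[0, 1[] and every
   floor is [0]. *)
have := shift m (t - m%:~R / K%:R); rewrite subrK => ->.
rewrite big1 ?add0r // => j _; apply: floor_def.
have /andP[m1 m2] := floor_itv (K%:R * t).
have -> : t - m%:~R / K%:R + j%:R / K%:R = (K%:R * t - m%:~R + j%:R) / K%:R.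
  by field; rewrite lt0r_neq0.
apply/andP; split.
  by rewrite divr_ge0 ?(ltW K0r) // addr_ge0 // subr_ge0.
rewrite add0r ltr_pdivrMr // mul1r.
have : (j%:R + 1 : R) <= K%:R by rewrite natr1 ler_nat.
move: m2; rewrite -/m intrD /=; lra.
Qed.

Lemma sum_periodic (V : nmodType) (f : nat -> V) (M g : nat) :
  (forall i, f (i + M)%N = f i) ->
  \sum_(i < g * M) f i = (\sum_(i < M) f i) *+ g.
Proof.
move=> fM; have fMk k i : f (k * M + i)%N = f i.
  by elim: k => [//|k IH]; rewrite mulSn -addnA addnC fM.
elim: g => [|g IH]; first by rewrite mul0n big_ord0 mulr0n.
rewrite mulSn addnC big_split_ord /= IH mulrSr; congr (_ + _).
by apply: eq_bigr => i _; rewrite fMk.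
Qed.

Lemma sum_coprime_mod (V : nmodType) (f : nat -> V) (M c : nat) :
  (0 < M)%N -> coprime c M ->
  \sum_(i < M) f ((c * i) %% M)%N = \sum_(i < M) f i.
Proof.
move=> M0 cM; pose h (i : 'I_M) := Ordinal (ltn_pmod (c * i) M0).
have hinj : injective h.
  have le_inj (i j : 'I_M) : (j <= i)%N -> h i = h j -> i = j.
    move=> ji /(congr1 val) /= /eqP.
    rewrite eqn_mod_dvd ?leq_mul2l ?ji ?orbT // -mulnBr Gauss_dvdr; last first.
      by rewrite coprime_sym.
    rewrite -eqn_mod_dvd // => /eqP; rewrite !modn_small // => ij.
    exact: val_inj.
  by move=> i j hij; case/orP: (leq_total j i) => ?; [|apply/esym]; apply: le_inj.
by rewrite [RHS](reindex_inj hinj).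
Qed.

(** With [g = gcdn c M] and [K = M / g], the points [c i / M] run [g] times through the multiples of
    [1 / K] modulo 1. Hermite's identity turns one run into [floor (K t) - floor (K t - K d)], which
    is within [1] of [K d]. *)
Lemma count_frac (R : realType) (M c : nat) (d t : R) :
  (0 < M)%N -> 0 <= d <= 1 ->
  `| \sum_(i < M) (frac (t + c%:R * i%:R / M%:R) < d)%R%:R - d * M%:R |
    <= (gcdn c M)%:R.
Proof.
move=> M0 d01; set g := gcdn c M.
have g0 : (0 < g)%N by rewrite gcdn_gt0 M0 orbT.
set K := (M %/ g)%N; have MK : M = (g * K)%N by rewrite mulnC divnK ?dvdn_gcdr.
set c' := (c %/ g)%N; have cc' : c = (g * c')%N by rewrite mulnC divnK ?dvdn_gcdl.
have K0 : (0 < K)%N by rewrite divn_gt0 // dvdn_leq // dvdn_gcdr.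
have cop : coprime c' K.
  rewrite /coprime -(eqn_pmul2l g0) muln_gcdr -cc' -MK muln1; exact: eqxx.
have gr : (0 : R) < g%:R by rewrite ltr0n.
have Kr : (0 : R) < K%:R by rewrite ltr0n.
pose f (i : nat) : R := (frac (t + i%:R / K%:R) < d)%R%:R.
have fK i : f (i + K)%N = f i.
  rewrite /f natrD mulrDl divff ?lt0r_neq0 // addrA.
  by rewrite (fracDn _ _ 1).
have fmod i : f (i %% K)%N = f i.
  rewrite [in RHS](divn_eq i K).
  elim: (i %/ K)%N => [|k ->]; first by rewrite mul0n.
  by rewrite mulSn -addnA [in RHS]addnC fK.
have -> : \sum_(i < M) (frac (t + c%:R * i%:R / M%:R) < d)%R%:R =
    (\sum_(i < K) f i) *+ g.
  rewrite -(sum_coprime_mod _ f _ c') //.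
  rewrite -(sum_periodic _ (fun i => f ((c' * i) %% K)%N)) ?MK; last first.
    by move=> i; rewrite mulnDr addnC modnMDl.
  apply: eq_bigr => i _; rewrite fmod /f; congr (frac _ < d)%R%:R.
  rewrite [in c%:R]cc' !natrM; congr (_ + _); field.
  by rewrite !lt0r_neq0.
have -> : \sum_(i < K) f i =
    (Num.floor (K%:R * t))%:~R - (Num.floor (K%:R * t - K%:R * d))%:~R.
  rewrite -mulrBr -!sum_floor // !rmorph_sum -sumrB; apply: eq_bigr => i _.
  by rewrite /f frac_lt_floor // addrAC.
have /andP[] := floor_itv (K%:R * t).
have /andP[] := floor_itv (K%:R * t - K%:R * d).
set a := Num.floor _; set b := Num.floor _ => a1 a2 b1 b2.
rewrite -[X in X - _]mulr_natl MK natrM.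
have -> : g%:R * (b%:~R - a%:~R) - d * (g%:R * K%:R) =
    g%:R * (b%:~R - a%:~R - K%:R * d) by ring.
rewrite normrM gtr0_norm // -[leRHS]mulr1 ler_pM2l //.
by move: a2 b2; rewrite !intrD /= ler_norml => a2 b2; apply/andP; split; lra.
Qed.

(** * Gcd sums *)

(** Integers coprime to [k] are coprime to [g], and coprimality to [g] has period [g], so that
    [k / g] periods hold [totient g] candidates each. *)
Lemma totient_dvd_le (g k : nat) : (0 < k)%N -> (g %| k)%N ->
  (totient k * g <= totient g * k)%N.
Proof.
move=> k0 /dvdnP[e ke]; rewrite ke mulnA leq_mul2r; apply/orP; right.
rewrite !totient_count_coprime !big_mkord.
have periodic i : coprime g (i + g) = coprime g i :> nat.
  by rewrite /coprime gcdnDr.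
have sumE : (\sum_(i < e * g) coprime g i = e * \sum_(i < g) coprime g i)%N.
  apply/eqP; rewrite -(eqr_nat int) natrM !natr_sum.
  rewrite (sum_periodic int (fun i => (coprime g i)%:R)) ?mulr_natl //.
  by move=> i; rewrite periodic.
rewrite [leqRHS]mulnC -sumE.
by apply: leq_sum => i _; rewrite coprimeMl; case: (coprime g i); rewrite ?andbF ?leq_b1.
Qed.

(** Write [n ^ 2] as the sum of [totient d * d * (n / d)] over [d | n], and [n / d] as the number of
    multiples of [d] among [1..n]. After exchanging the sums, each [k] retains at least the term
    [d = gcdn n k]. *)
Lemma sum_totient_gcd (n : nat) :
  (\sum_(1 <= k < n.+1) totient (gcdn n k) * gcdn n k <= n ^ 2)%N.
Proof.
have [->|n0] := posnP n; first by rewrite big_nil.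
pose F d := (totient d * d)%N.
have -> : (n ^ 2 = \sum_(d < n.+1 | d %| n) F d * (n %/ d))%N.
  rewrite -mulnn -{1}[n in LHS]sum_totient_dvd big_distrl /=.
  by apply: eq_bigr => d dn; rewrite /F -mulnA [(d * (n %/ d))%N]mulnC divnK.
under [leqRHS]eq_bigr do rewrite divn_count_dvd big_distrr /=.
rewrite exchange_big /= big_seq [leqRHS]big_seq; apply: leq_sum => k.
rewrite mem_index_iota => /andP[k0 kn].
have gn : (gcdn n k < n.+1)%N by rewrite ltnS dvdn_leq // dvdn_gcdl.
rewrite (bigD1 (Ordinal gn)) /= ?dvdn_gcdl // dvdn_gcdr muln1.
exact: leq_addr.
Qed.

Lemma sum_weight_gcd (R : realType) (n : nat) :
  \sum_(k < n.+1) (totient k)%:R / k%:R * (gcdn n k)%:R ^+ 2 <= n%:R ^+ 2 :> R.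
Proof.
rewrite -natrX; apply: le_trans (_ : (\sum_(1 <= k < n.+1)
    totient (gcdn n k) * gcdn n k)%N%:R <= _); last first.
  by rewrite ler_nat sum_totient_gcd.
rewrite natr_sum -(big_mkord xpredT (fun k => (totient k)%:R / k%:R * (gcdn n k)%:R ^+ 2 : R)).
(* The term [k = 0] vanishes, since [0^-1 = 0]. *)
rewrite big_nat_recl // invr0 mulr0 mul0r add0r big_add1 /=.
apply: ler_sum => k _; set g := gcdn n k.+1.
have k0 : (0 : R) < k.+1%:R by rewrite ltr0n.
rewrite expr2 mulrA natrM ler_wpM2r ?ler0n // mulrAC ler_pdivrMr //.
by rewrite -!natrM ler_nat totient_dvd_le // dvdn_gcdr.
Qed.

(** With [n = n' g] and [k = k' g], coprimality of [n'] and [k'] forces [(j, l) = (n' a, k' a)], and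
    the ranges leave only [a < g]. *)
Lemma count_parallel (n k : nat) :
  (\sum_(j < n) \sum_(l < k) (n * l == j * k) <= gcdn n k)%N.
Proof.
have [->|n0] := posnP n; first by rewrite big_ord0.
have [->|k0] := posnP k.
  by rewrite big1 // => j _; rewrite big_ord0.
set g := gcdn n k; have g0 : (0 < g)%N by rewrite gcdn_gt0 n0.
rewrite pair_big /= (eq_bigr (fun p : 'I_n * 'I_k =>
    if (n * p.2 == p.1 * k)%N then 1 else 0)%N); last by move=> p _; case: eqP.
rewrite -big_mkcond /= sum1_card.
have gn : (g %| n)%N by exact: dvdn_gcdl.
have gk : (g %| k)%N by exact: dvdn_gcdr.
set n' := (n %/ g)%N; set k' := (k %/ g)%N.
have nE : n = (n' * g)%N by rewrite divnK.
have kE : k = (k' * g)%N by rewrite divnK.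
have n'0 : (0 < n')%N by rewrite divn_gt0 // dvdn_leq.
have k'0 : (0 < k')%N by rewrite divn_gt0 // dvdn_leq.
have cop : coprime k' n'.
  rewrite coprime_sym /coprime -(eqn_pmul2r g0) muln_gcdl -nE -kE mul1n; exact: eqxx.
have lt1 (a : 'I_g) : (n' * a < n)%N by rewrite nE ltn_pmul2l.
have lt2 (a : 'I_g) : (k' * a < k)%N by rewrite kE ltn_pmul2l.
pose h a := (Ordinal (lt1 a), Ordinal (lt2 a)).
rewrite -[leqRHS]card_ord -cardsT.
apply: leq_trans (leq_imset_card h _); apply/subset_leq_card/fintype.subsetP.
move=> [j l]; rewrite unfold_in /= => /eqP njk.
have e1 : (n' * l = j * k')%N.
  apply/eqP; rewrite -(eqn_pmul2r g0) -[X in _ == X]mulnA -kE.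
  by rewrite mulnAC -nE njk.
have /dvdnP[a la] : (k' %| l)%N.
  by rewrite -(Gauss_dvdr _ cop) e1 dvdn_mull.
have ag : (a < g)%N by rewrite -(ltn_pmul2r k'0) -la [X in (_ < X)%N]mulnC -kE.
apply/imsetP; exists (Ordinal ag); rewrite ?inE //.
congr pair; apply/val_inj => /=; last by rewrite la mulnC.
by apply/eqP; rewrite -(eqn_pmul2r k'0) -e1 la; rewrite -mulnA.
Qed.

(** * Lebesgue measure on the torus *)

Lemma measurable_frac (R : realType) : measurable_fun [set: R] (@frac R).
Proof.
apply: measurable_funB; first exact: measurable_id.
apply: nondecreasing_measurable => // x y xy.
by rewrite ler_int le_floor.
Qed.

Lemma lebesgue_measure_translation (R : realType) (s : R)
    (A : set (measurableTypeR R)) : measurable A ->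
  @lebesgue_measure R ((fun x => x + s) @^-1` A) = lebesgue_measure A.
Proof.
move=> mA; rewrite -[LHS]/(pushforward (@lebesgue_measure R)
  (fun x : measurableTypeR R => x + s : measurableTypeR R) A).
have ms : measurable_fun [set: measurableTypeR R]
    (fun x : measurableTypeR R => x + s : measurableTypeR R).
  by apply: measurable_funD; [exact: measurable_id|exact: measurable_cst].
apply/esym/lebesgue_measure_unique => //= _ [[a b]] _ <-.
rewrite /pushforward /=.
rewrite (_ : _ @^-1` _ = `]a - s, b - s]%classic); last first.
  apply/seteqP; split => x /=; rewrite !in_itv /=;
    by rewrite ltrBlDr lerBrDr.
rewrite !lebesgue_measure_itv /= !lte_fin ltrD2r; case: ifP => // _.
by rewrite -!EFinB; congr (_%:E); ring.
Qed.

(** The circle is modelled on the whole line, by a probability carried by [[0, 1[]; sets need only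
    be compared on that interval. *)
Definition unif (R : realType) : set (measurableTypeR R) -> \bar R :=
  mrestr (@lebesgue_measure R) (measurable_itv `[0, 1[%R).

HB.instance Definition _ (R : realType) := Measure.on (@unif R).

Lemma unif_setT (R : realType) : @unif R setT = 1%E.
Proof.
by rewrite /unif /mrestr setTI lebesgue_measure_itv /= lte_fin ltr01 oppr0 addr0.
Qed.

HB.instance Definition _ (R : realType) :=
  Measure_isProbability.Build _ _ _ (@unif R) (@unif_setT R).

Definition unif2 (R : realType) :
    set (measurableTypeR R * measurableTypeR R) -> \bar R :=
  (@unif R \x @unif R)%E.

HB.instance Definition _ (R : realType) := Measure.on (@unif2 R).

Lemma unif2X (R : realType) (A B : set (measurableTypeR R)) :
  measurable A -> measurable B -> unif2 R (A `*` B) = (unif R A * unif R B)%E.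
Proof. by move=> mA mB; rewrite /unif2 product_measure1E. Qed.

Lemma unif2_setT (R : realType) : @unif2 R setT = 1%E.
Proof. by rewrite -setXTT unif2X // unif_setT mule1. Qed.

HB.instance Definition _ (R : realType) :=
  Measure_isProbability.Build _ _ _ (@unif2 R) (@unif2_setT R).

Definition rot {R : realType} (s : R) (x : measurableTypeR R) : measurableTypeR R :=
  frac (x + s).

Definition rot2 {R : realType} (s : R * R)
    (x : measurableTypeR R * measurableTypeR R) :
    measurableTypeR R * measurableTypeR R :=
  (rot s.1 x.1, rot s.2 x.2).

Lemma measurable_rot (R : realType) (s : R) : measurable_fun setT (@rot R s).
Proof.
apply: (@measurableT_comp _ _ _ _ _ _ (@frac R)); first exact: measurable_frac.
by apply: measurable_funD; [exact: measurable_id|exact: measurable_cst].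
Qed.

Lemma measurable_rot2 (R : realType) (s : R * R) : measurable_fun setT (@rot2 R s).
Proof.
apply: measurable_fun_pair; apply: measurableT_comp;
  by [exact: measurable_rot|exact: measurable_fst|exact: measurable_snd].
Qed.

(** With [c = frac s], the preimage within [[0, 1[] splits into the points with [x + c < 1] and
    those that wrap around; translations carry the two pieces onto [A] within [[c, 1[] and [A]
    within [[0, c[]. *)
Lemma unif_rot (R : realType) (s : R) (A : set (measurableTypeR R)) :
  measurable A -> unif R (rot s @^-1` A) = unif R A.
Proof.
move=> mA; have rotE x : rot s x = frac (x + frac s) by rewrite fracD_frac.
have := frac_ge0 _ s; have := frac_lt1 _ s; move: (frac s) rotE => c rotE c1 c0.
have mI (a b : R) : measurable ([set` `[a, b[%R] : set (measurableTypeR R)).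
  exact: measurable_itv.
have mAI (a b : R) : measurable (A `&` `[a, b[ : set (measurableTypeR R)).
  exact: measurableI.
have mtr (t : R) (B : set (measurableTypeR R)) : measurable B ->
    measurable ((fun x : measurableTypeR R => x + t) @^-1` B).
  move=> mB; rewrite -[X in measurable X]setTI.
  have mt : measurable_fun setT
      (fun x : measurableTypeR R => x + t : measurableTypeR R).
    by apply: measurable_funD; [exact: measurable_id|exact: measurable_cst].
  exact: mt.
rewrite /unif /mrestr.
rewrite (_ : rot s @^-1` A `&` _ =
   (fun x => x + c) @^-1` (A `&` `[c, 1[) `|`
   (fun x => x + (c - 1)) @^-1` (A `&` `[0, c[)); last first.
  apply/seteqP; split => x /=; rewrite !in_itv /= rotE.
    move=> [Ax /andP[x0 x1]]; have [xc|xc] := ltP (x + c) 1.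
      left; move: Ax; rewrite frac_id ?addr_ge0 //=; split => //.
      by apply/andP; split; lra.
    right; move: Ax; rewrite (@frac_def _ _ 1); last by apply/andP; split; lra.
    by rewrite -addrA; split => //; apply/andP; split; lra.
  move=> [[Ax /andP[h1 h2]]|[Ax /andP[h1 h2]]].
    rewrite frac_id; first by split => //; apply/andP; split; lra.
    by apply/andP; split; lra.
  rewrite (@frac_def _ _ 1) -?addrA; first by split => //; apply/andP; split; lra.
  by apply/andP; split; lra.
rewrite measureU; [|exact: mtr|exact: mtr|]; last first.
  apply/seteqP; split => x //= [[_ +] [_ +]]; rewrite !in_itv /=.
  by move=> /andP[h1 h2] /andP[h3 h4]; lra.
transitivity (lebesgue_measure (A `&` `[c, 1%R[) +
    lebesgue_measure (A `&` `[0%R, c[))%E.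
  by congr (_ + _)%E; exact: lebesgue_measure_translation.
rewrite -measureU //; last first.
  apply/seteqP; split => x //= [[_ +] [_ +]]; rewrite !in_itv /=.
  by move=> /andP[h1 h2] /andP[h3 h4]; lra.
congr (lebesgue_measure _); apply/seteqP; split => x /=; rewrite !in_itv /=.
  by move=> [[Ax /andP[h1 h2]]|[Ax /andP[h1 h2]]]; split => //; apply/andP; split; lra.
move=> [Ax /andP[h1 h2]]; have [xc|xc] := ltP x c; [right|left]; split => //.
by rewrite h1.
Qed.

Lemma unif2_rot (R : realType) (s : R * R)
    (A : set (measurableTypeR R * measurableTypeR R)) :
  measurable A -> unif2 R (rot2 s @^-1` A) = unif2 R A.
Proof.
move=> mA; rewrite -[LHS]/(pushforward (unif2 R) (rot2 s) A).
have mr2 := measurable_rot2 _ s.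
apply/esym/product_measure_unique => //= B C mB mC; rewrite /pushforward.
rewrite (_ : _ @^-1` _ = (rot s.1 @^-1` B) `*` (rot s.2 @^-1` C)) //.
have mr (t : R) (D : set (measurableTypeR R)) : measurable D ->
    measurable (rot t @^-1` D).
  by move=> mD; rewrite -[X in measurable X]setTI; exact: measurable_rot.
by rewrite unif2X ?unif_rot //; exact: mr.
Qed.

(** * Averages of indicator functions *)

Section FiniteCombinations.
Context d (T : measurableType d) (R : realType) (P : probability T R).
Implicit Types (A B : set T) (f g : T -> R).

Definition pr A : R := fine (P A).

Lemma prE A : measurable A -> P A = (pr A)%:E.
Proof. by move=> mA; rewrite /pr fineK // fin_num_measure. Qed.

Lemma pr_ge0 A : 0 <= pr A.
Proof. exact/fine_ge0/measure_ge0. Qed.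

Lemma pr_setT : pr setT = 1.
Proof. by rewrite /pr probability_setT. Qed.

Lemma pr_set0 : pr set0 = 0.
Proof. by rewrite /pr measure0. Qed.

Lemma pr_le A B : measurable A -> measurable B -> A `<=` B -> pr A <= pr B.
Proof.
move=> mA mB AB; rewrite -lee_fin -!prE //.
by apply: le_measure; rewrite ?inE.
Qed.

Lemma prU A B : measurable A -> measurable B -> A `&` B = set0 ->
  pr (A `|` B) = pr A + pr B.
Proof.
by move=> mA mB AB; rewrite /pr measureU // fineD ?fin_num_measure.
Qed.

(** Integrability travels with the value, so that means of finite combinations of indicators follow
    from the rules below without side conditions. *)
Definition has_mean f r :=
  P.-integrable setT (EFin \o f) /\ (\int[P]_x (f x)%:E = r%:E)%E.

Lemma has_mean_indic A : measurable A -> has_mean \1_A (pr A).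
Proof.
move=> mA; split; first exact: integrable_indic.
by rewrite integral_indic // setIT; exact: prE.
Qed.

Lemma has_meanZ c f r : has_mean f r -> has_mean (fun x => c * f x) (c * r).
Proof.
move=> [fi fr]; split; last by under eq_integral do rewrite EFinM; rewrite integralZl // fr.
exact: (integrableZl _ c fi).
Qed.

Lemma has_meanD f g r s : has_mean f r -> has_mean g s ->
  has_mean (fun x => f x + g x) (r + s).
Proof.
move=> [fi fr] [gi gr]; split; first exact: (integrableD _ fi gi).
by under eq_integral do rewrite EFinD; rewrite integralD // fr gr.
Qed.

Lemma has_mean_sum (I : Type) (s : seq I) (F : I -> T -> R) (r : I -> R) :
  (forall i, has_mean (F i) (r i)) ->
  has_mean (fun x => \sum_(i <- s) F i x) (\sum_(i <- s) r i).
Proof.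
move=> Fr; elim: s => [|i s IH].
  rewrite big_nil -[X in has_mean _ X]pr_set0.
  rewrite (_ : (fun _ => _) = \1_set0); first exact: has_mean_indic.
  by apply/funext => x; rewrite big_nil indicE in_set0.
rewrite big_cons; under eq_fun do rewrite big_cons.
exact: has_meanD (Fr i) IH.
Qed.

Lemma has_mean_le f g r s : has_mean f r -> has_mean g s ->
  (forall x, f x <= g x) -> r <= s.
Proof.
move=> [fi fr] [gi gs] fg; rewrite -lee_fin -fr -gs.
by apply: le_integral => // x _; rewrite lee_fin.
Qed.

(* The functions [\1_A * \1_B \o tau i] all have mean [pr (A `&` B)]: sum them over [i]. *)
Lemma pr_orbit_average (M : nat) (tau : nat -> T -> T) A B (c e : R) :
  (0 < M)%N -> measurable A -> measurable B ->
  (forall i D, measurable D -> measurable (tau i @^-1` D)) ->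
  (forall i D, measurable D -> P (tau i @^-1` D) = P D) ->
  (forall i, (i < M)%N -> tau i @^-1` A = A) ->
  (forall x, A x -> `| \sum_(i < M) \1_B (tau i x) - c * M%:R | <= e) ->
  `| pr (A `&` B) - c * pr A | <= e / M%:R * pr A.
Proof.
move=> M0 mA mB mtau ptau Atau He.
have Mr : (0 : R) < M%:R by rewrite ltr0n.
pose f x := \sum_(i < M) \1_(A `&` tau i @^-1` B) x : R.
have fmean : has_mean f (M%:R * pr (A `&` B)).
  have -> : M%:R * pr (A `&` B) = \sum_(i < M) pr (A `&` tau i @^-1` B).
    rewrite (eq_bigr (fun=> pr (A `&` B))); first by rewrite sumr_const card_ord mulr_natl.
    (* By invariance [A] may be replaced by its preimage; the whole intersection is then a preimage
       under [tau i]. *)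
    move=> i _; rewrite /pr -[in X in P (X `&` _)](Atau i (ltn_ord i)) -preimage_setI.
    by rewrite ptau //; exact: measurableI.
  apply: (has_mean_sum _ _ (fun i : 'I_M => \1_(A `&` tau i @^-1` B))) => i.
  by apply: has_mean_indic; apply: measurableI => //; exact: mtau.
have fE x : f x = \1_A x * \sum_(i < M) \1_B (tau i x).
  rewrite mulr_sumr; apply: eq_bigr => i _.
  by rewrite indicI.
have bnd x : \1_A x * (c * M%:R - e) <= f x <= \1_A x * (c * M%:R + e).
  rewrite fE indicE; case: (boolP (x \in A)) => [/set_mem Ax|_]; last by rewrite !mul0r lexx.
  rewrite !mul1r.
  by have := He _ Ax; rewrite ler_distl.
have lo := has_mean_le _ _ _ _ (has_meanZ (c * M%:R - e) _ _ (has_mean_indic _ mA)) fmean.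
have hi := has_mean_le _ _ _ _ fmean (has_meanZ (c * M%:R + e) _ _ (has_mean_indic _ mA)).
have {}lo : (c * M%:R - e) * pr A <= M%:R * pr (A `&` B).
  by apply: lo => x; rewrite mulrC; case/andP: (bnd x).
have {}hi : M%:R * pr (A `&` B) <= (c * M%:R + e) * pr A.
  by apply: hi => x; rewrite mulrC; case/andP: (bnd x).
have eE : e = M%:R * (e / M%:R) by rewrite mulrC divfK ?lt0r_neq0.
move: lo hi; rewrite [in X in X -> _]eE [in X in _ -> X -> _]eE.
rewrite ![c * _]mulrC -mulrBr -mulrDr -!mulrA !ler_pM2l // => lo hi.
by rewrite ler_norml; apply/andP; split; lra.
Qed.

(* Integrate [f \1_F <= f^2 / (2 t) + (t / 2) \1_F], where [f] is the weighted sum of the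
   [\1_(E n j)]. *)
Lemma pr_second_moment (N : nat) (J : nat -> nat) (w : nat -> R)
    (E : nat -> nat -> set T) (F : set T) (t : R) :
  0 < t -> measurable F -> (forall n j, measurable (E n j)) ->
  \sum_(n < N) w n * \sum_(j < J n) pr (E n j `&` F) <=
  (2 * t)^-1 * (\sum_(n < N) \sum_(k < N) w n * w k *
     \sum_(i < J n) \sum_(j < J k) pr (E n i `&` E k j)) + t / 2 * pr F.
Proof.
move=> t0 mF mE.
pose f x := \sum_(n < N) w n * \sum_(j < J n) \1_(E n j) x : R.
apply: (has_mean_le (fun x => f x * \1_F x)
  (fun x => (2 * t)^-1 * (f x * f x) + t / 2 * \1_F x)).
- rewrite (_ : (fun x => _) = fun x =>
      \sum_(n < N) w n * \sum_(j < J n) \1_(E n j `&` F) x); last first.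
    apply/funext => x; rewrite mulr_suml; apply: eq_bigr => n _.
    rewrite -mulrA mulr_suml; congr (_ * _); apply: eq_bigr => j _.
    by rewrite indicI.
  apply: has_mean_sum => n; apply: has_meanZ; apply: has_mean_sum => j.
  by apply: has_mean_indic; exact: measurableI.
- apply: has_meanD; apply: has_meanZ; last exact: has_mean_indic.
  rewrite (_ : (fun x => _) = fun x => \sum_(n < N) \sum_(k < N) w n * w k *
     \sum_(i < J n) \sum_(j < J k) \1_(E n i `&` E k j) x); last first.
    apply/funext => x; rewrite mulr_suml; apply: eq_bigr => n _.
    rewrite mulr_sumr; apply: eq_bigr => k _; rewrite mulrACA; congr (_ * _).
    rewrite mulr_suml; apply: eq_bigr => i _; rewrite mulr_sumr.
    by apply: eq_bigr => j _; rewrite indicI.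
  apply: has_mean_sum => n; apply: has_mean_sum => k; apply: has_meanZ.
  apply: has_mean_sum => i; apply: has_mean_sum => j.
  by apply: has_mean_indic; exact: measurableI.
- move=> x; have f2 : 0 <= f x * f x by rewrite -expr2 sqr_ge0.
  rewrite indicE; case: (_ \in _); rewrite /= ?mulr0 ?mulr1 ?addr0; last first.
    by rewrite mulr_ge0 // invr_ge0; lra.
  (* On [F] the two sides differ by the square [(f - t)^2 / (2 t)]. *)
  have -> : (2 * t)^-1 * (f x * f x) + t / 2 = f x + (2 * t)^-1 * ((f x - t) * (f x - t)).
    by field; rewrite lt0r_neq0.
  by rewrite lerDl mulr_ge0 // ?invr_ge0 -?expr2 ?sqr_ge0 //; lra.
Qed.

End FiniteCombinations.

Arguments pr {d T R} P A.

(** * Limsup sets of full probability *)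

Section LimsupSets.
Context d (T : measurableType d) (R : realType) (P : probability T R).
Variables (J : nat -> nat) (w : nat -> R) (E : nat -> nat -> set T) (C : R).
Hypothesis w0 : forall n, 0 <= w n.
Hypothesis mE : forall n j, measurable (E n j).
Implicit Types F G : set T.

(** This is the integral over [F] of the weighted counting function of the sets; divided by [S N],
    it is the integral of [f N] over [F]. *)
Definition mass (N : nat) F : R :=
  \sum_(n < N) w n * \sum_(j < J n) pr P (E n j `&` F).

Local Notation S N := (mass N setT).

Hypothesis S_unbounded : forall a : R, exists N, a <= S N.
Hypothesis C0 : 0 < C.
(** The left side is the integral of the squared counting function, so this is the L^2-boundedness
    of its normalization by [S N]. *)
Hypothesis pair_bound : forall N, 1 <= S N ->
  \sum_(n < N) \sum_(k < N) w n * w k *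
     \sum_(i < J n) \sum_(j < J k) pr P (E n i `&` E k j) <= C * S N ^+ 2.

Lemma mass_ge0 N F : 0 <= mass N F.
Proof.
by apply: sumr_ge0 => n _; rewrite mulr_ge0 // sumr_ge0 // => j _; exact: pr_ge0.
Qed.

Lemma massU N F G : measurable F -> measurable G -> F `&` G = set0 ->
  mass N (F `|` G) = mass N F + mass N G.
Proof.
move=> mF mG FG; rewrite /mass -big_split; apply: eq_bigr => n _ /=.
rewrite -mulrDr -big_split; congr (_ * _); apply: eq_bigr => j _ /=.
rewrite setIUr prU //; [exact: measurableI|exact: measurableI|].
by rewrite setIACA FG setI0.
Qed.

Lemma mass_le_time M N F : (M <= N)%N -> mass M F <= mass N F.
Proof.
move=> MN; rewrite /mass -!(big_mkord xpredT (fun n => w n * \sum_(j < J n) pr P (E n j `&` F))).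
rewrite [leRHS](big_cat_nat (n := M)) //= lerDl sumr_ge0 // => n _.
by rewrite mulr_ge0 // sumr_ge0 // => j _; exact: pr_ge0.
Qed.

Lemma S_large (a : R) : exists N0, forall N, (N0 <= N)%N -> a <= S N.
Proof.
have [N0 aN0] := S_unbounded a; exists N0 => N N0N.
exact: le_trans aN0 (mass_le_time _ _ _ N0N).
Qed.

(* The weighted averages [mass N F / S N] converge to the probability of [F]. *)
Definition equidistributed F := forall e : R, 0 < e ->
  exists N0, forall N, (N0 <= N)%N -> `|mass N F - pr P F * S N| <= e * S N.

Lemma equidistributed_set0 : equidistributed set0.
Proof.
move=> e e0; exists 0%N => N _; rewrite pr_set0 mul0r subr0 /mass big1 => [|n _].
  by rewrite normr0 mulr_ge0 ?mass_ge0 // ltW.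
by rewrite big1 ?mulr0 // => j _; rewrite setI0 pr_set0.
Qed.

Lemma equidistributedU F G : measurable F -> measurable G -> F `&` G = set0 ->
  equidistributed F -> equidistributed G -> equidistributed (F `|` G).
Proof.
move=> mF mG FG eF eG e e0; have e2 : 0 < e / 2 by lra.
have [M HM] := eF _ e2; have [N HN] := eG _ e2.
exists (maxn M N) => n; rewrite geq_max => /andP[/HM {}HM /HN {}HN].
rewrite massU // prU //.
have -> : mass n F + mass n G - (pr P F + pr P G) * S n =
  (mass n F - pr P F * S n) + (mass n G - pr P G * S n) by ring.
apply: le_trans (ler_normD _ _) _.
have -> : e * S n = e / 2 * S n + e / 2 * S n by field.
exact: lerD.
Qed.

Lemma equidistributedD F G : measurable F -> measurable G -> F `<=` G ->
  equidistributed F -> equidistributed G -> equidistributed (G `\` F).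
Proof.
move=> mF mG FG eF eG e e0; have e2 : 0 < e / 2 by lra.
have [M HM] := eF _ e2; have [N HN] := eG _ e2.
exists (maxn M N) => n; rewrite geq_max => /andP[/HM {}HM /HN {}HN].
have GE : G = F `|` (G `\` F) by rewrite setDUK.
have mD : measurable (G `\` F) by exact: measurableD.
have disj : F `&` (G `\` F) = set0 by rewrite setDIK.
move: HN; rewrite [in mass n G]GE [in pr P G]GE massU // prU // => HN.
have -> : mass n (G `\` F) - pr P (G `\` F) * S n =
  (mass n F + mass n (G `\` F) - (pr P F + pr P (G `\` F)) * S n) -
  (mass n F - pr P F * S n) by ring.
apply: le_trans (ler_normB _ _) _.
have -> : e * S n = e / 2 * S n + e / 2 * S n by field.
exact: lerD.
Qed.

(** This is where L^2-boundedness enters. Finitely many [F k] are handled by additivity; the rest of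
    the union has small probability, and the second moment bound, with parameter proportional to
    [S n], makes its mass a small fraction of [S n]. *)
Lemma equidistributed_bigcup (F : (set T)^nat) :
  (forall k, measurable (F k)) -> trivIset setT F ->
  (forall k, equidistributed (F k)) -> equidistributed (\bigcup_k F k).
Proof.
move=> mF tF eF e e0.
pose G K := \big[setU/set0]_(k < K) F k.
have mG K : measurable (G K) by apply: bigsetU_measurable => k _.
have mU : measurable (\bigcup_k F k) by exact: bigcupT_measurable.
have GU K : G K `<=` \bigcup_k F k by exact: bigsetU_bigcup.
have eG K : equidistributed (G K).
  elim: K => [|K IH]; first by rewrite /G big_ord0; exact: equidistributed_set0.
  rewrite /G big_ord_recr /=; apply: equidistributedU => //; first exact: mG.
  rewrite /G -bigcup_mkord setI_bigcupl; apply: bigcup0 => k /= kK.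
  by move/trivIsetP : tF => /(_ k K Logic.I Logic.I) -> //; rewrite ltn_eqF.
(* The second moment bound is used with parameter [tau * S n]. This [tau] makes its square term
   [e / 4 * S n]; [eta <= e / (2 * tau)] does the same for the linear term, and [eta <= e / 4]
   controls [pr P D * S n]. *)
pose tau := 2 * C / e; have tau0 : 0 < tau by rewrite divr_gt0 // mulr_gt0.
pose eta := Num.min (e / 4) (e / (2 * tau)).
have eta0 : 0 < eta.
  by rewrite lt_min !divr_gt0 // mulr_gt0.
have [K HK] : exists K, pr P (\bigcup_k F k) - pr P (G K) <= eta.
  have Gcvg : P (G n) @[n --> \oo] --> P (\bigcup_n G n).
    apply: nondecreasing_cvg_mu => //; first exact: bigcupT_measurable.
    by move=> m n mn; apply/subsetPset; exact: subset_bigsetU.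
  have UE : \bigcup_n G n = \bigcup_k F k.
    by apply/seteqP; split; [apply: bigcup_sub => n _; exact: GU
      |move=> x [k _ Fx]; exists k.+1 => //; rewrite /G -bigcup_mkord; exists k => /=].
  move: Gcvg; rewrite UE prE // => /fine_cvgP[_ /cvgrPdist_le /(_ _ eta0)].
  move=> [K _ /(_ K (leqnn K))] /= h; exists K.
  by apply: le_trans h; exact: ler_norm.
pose D := \bigcup_k F k `\` G K.
have mD : measurable D by exact: measurableD.
have UGD : \bigcup_k F k = G K `|` D by rewrite setDUK.
have disj : G K `&` D = set0 by rewrite setDIK.
have prD : pr P D <= eta by move: HK; rewrite [in pr P (\bigcup_k _)]UGD prU // addrC addKr.
have e4 : 0 < e / 4 by lra.
have [N1 H1] := eG K _ e4; have [N2 H2] := S_large 1.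
exists (maxn N1 N2) => n; rewrite geq_max => /andP[/H1 {}H1 /H2 S1].
have S0 : 0 < S n by lra.
have massD : mass n D <= e / 2 * S n.
  have tS : 0 < tau * S n by rewrite mulr_gt0.
  apply: le_trans (pr_second_moment _ _ _ _ _ _ w _ _ _ tS mD mE) _.
  apply: le_trans (_ : (2 * (tau * S n))^-1 * (C * S n ^+ 2) + tau * S n / 2 * eta <= _).
    apply: lerD; first by rewrite ler_pM2l ?pair_bound // invr_gt0 mulr_gt0.
    by rewrite ler_pM2l // divr_gt0.
  have -> : (2 * (tau * S n))^-1 * (C * S n ^+ 2) = e / 4 * S n.
    by rewrite /tau; field; rewrite !lt0r_neq0.
  have -> : e / 2 * S n = e / 4 * S n + e / 4 * S n by field.
  rewrite lerD2l.
  have etaE : eta <= e / (2 * tau) by rewrite ge_min lexx orbT.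
  apply: le_trans (_ : tau * S n / 2 * (e / (2 * tau)) <= _).
    by rewrite ler_pM2l // divr_gt0.
  have -> : tau * S n / 2 * (e / (2 * tau)) = e / 4 * S n.
    by field; rewrite lt0r_neq0.
  exact: lexx.
rewrite UGD massU // prU //.
have -> : mass n (G K) + mass n D - (pr P (G K) + pr P D) * S n =
  (mass n (G K) - pr P (G K) * S n) + (mass n D - pr P D * S n) by ring.
apply: le_trans (ler_normD _ _) _.
have -> : e * S n = e / 4 * S n + (e / 2 + e / 4) * S n by field.
apply: lerD => //; apply: le_trans (ler_normB _ _) _.
rewrite !ger0_norm ?mass_ge0 //; last by rewrite mulr_ge0 ?pr_ge0 // ltW.
rewrite mulrDl lerD // ler_pM2r //.
by apply: le_trans prD _; rewrite ge_min lexx.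
Qed.

Definition late_misses (K : nat) : set T :=
  [set x | forall n j, (K <= n)%N -> (j < J n)%N -> ~ E n j x].

Definition limsup_sets : set T :=
  [set x | forall K, exists n j, [/\ (K <= n)%N, (j < J n)%N & E n j x]].

Lemma measurable_late_misses K : measurable (late_misses K).
Proof.
rewrite (_ : late_misses K = \bigcap_n \bigcap_j
    (if (K <= n)%N && (j < J n)%N then ~` E n j else setT)).
  apply: bigcapT_measurable => n; apply: bigcapT_measurable => j.
  by case: ifP => // _; exact: measurableC.
apply/seteqP; split => x h n.
  by move=> _ j _; case: ifP => // /andP[Kn jJ]; exact: h.
by move=> j Kn jJ; have := h n Logic.I j Logic.I; rewrite Kn jJ.
Qed.

Lemma limsup_setsE : limsup_sets = ~` (\bigcup_K late_misses K).
Proof.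
apply/seteqP; split => x.
  by move=> h [K _ miss]; have [n [j [Kn jJ Ex]]] := h K; exact: (miss n j).
move=> h K; apply: contrapT => noE; apply: h; exists K => // n j Kn jJ Ex.
by apply: noE; exists n, j.
Qed.

Lemma measurable_limsup_sets : measurable limsup_sets.
Proof.
rewrite limsup_setsE; apply: measurableC; apply: bigcupT_measurable => K.
exact: measurable_late_misses.
Qed.

Hypothesis equi : forall F, measurable F -> equidistributed F.

(** A set missed from [K] on has mass at most [S K] for every [N], while equidistribution makes this
    mass about [pr P L * S N]; as [S N] is unbounded, [pr P L] vanishes. *)
Lemma pr_late_misses K : P (late_misses K) = 0%E.
Proof.
have mL := measurable_late_misses K; set L := late_misses K in mL *.
have massL N : mass N L <= S K.
  have [NK|KN] := leqP N K.
    apply: le_trans (mass_le_time _ _ _ NK).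
    apply: ler_sum => n _; rewrite ler_wpM2l //; apply: ler_sum => j _.
    by apply: pr_le; [exact: measurableI|exact: measurableI|exact: setIS].
  rewrite /mass -!(big_mkord xpredT (fun n => w n * \sum_(j < J n) pr P (E n j `&` _))).
  rewrite (big_cat_nat (n := K)) //=; last exact: ltnW.
  rewrite [X in _ + X]big_nat_cond [X in _ + X]big1 ?addr0; last first.
    move=> n /andP[/andP[Kn _] _]; rewrite big1 ?mulr0 // => j _.
    rewrite (_ : _ `&` _ = set0) ?pr_set0 //; apply/seteqP; split => x //= [Ex Lx].
    exact: (Lx n j Kn (ltn_ord j) Ex).
  apply: ler_sum => n _; rewrite ler_wpM2l //; apply: ler_sum => j _.
  by apply: pr_le; [exact: measurableI|exact: measurableI|exact: setIS].
rewrite prE //; congr (_%:E); apply/eqP; rewrite eq_le pr_ge0 andbT.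
apply/ler_addgt0Pr => e e0; rewrite add0r; have e2 : 0 < e / 2 by lra.
have [N1 H1] := equi _ mL _ e2; have [N2 H2] := S_large (Num.max 1 (S K / (e / 2))).
have {}H1 := H1 _ (leq_maxl N1 N2); have := H2 _ (leq_maxr N1 N2).
rewrite ge_max => /andP[S1 SK]; set N := maxn N1 N2 in H1 S1 SK *.
have S0 : 0 < S N by lra.
rewrite -(ler_pM2r S0); move: H1; rewrite ler_norml => /andP[H1 _].
have LN := massL N; move: SK; rewrite ler_pdivrMr // => SK.
lra.
Qed.

Lemma pr_limsup_sets : P limsup_sets = 1%E.
Proof.
have mL K := measurable_late_misses K.
rewrite limsup_setsE probability_setC; last exact: bigcupT_measurable.
suff -> : P (\bigcup_K late_misses K) = 0%E by rewrite sube0.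
apply/eqP; rewrite eq_le measure_ge0 andbT.
have mU : measurable (\bigcup_K late_misses K) by exact: bigcupT_measurable.
apply: le_trans (generalized_Boole_inequality P mL mU) _.
by rewrite eseries0 // => K _ _; exact: pr_late_misses.
Qed.

End LimsupSets.

Arguments mass {d T R} P J w E N F.
Arguments equidistributed {d T R} P J w E F.
Arguments limsup_sets {d T} J E.

(** Three inductions: on the first factor, on the second, then from rectangles to the product
    sigma-algebra. The full space joins each generating family because complements in one factor are
    taken as differences from a full strip. *)
Lemma dynkin_rectangles d1 d2 (T1 : measurableType d1) (T2 : measurableType d2)
    (G1 : set (set T1)) (G2 : set (set T2)) (Q : set (set (T1 * T2))) :
  @measurable _ T1 = <<s G1 >> -> @measurable _ T2 = <<s G2 >> ->
  setI_closed G1 -> setI_closed G2 ->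
  (forall A B, G1 A \/ A = setT -> G2 B \/ B = setT -> Q (A `*` B)) ->
  (forall F G, measurable F -> measurable G -> F `<=` G -> Q F -> Q G -> Q (G `\` F)) ->
  (forall F : (set (T1 * T2))^nat, (forall k, measurable (F k)) ->
     trivIset setT F -> (forall k, Q (F k)) -> Q (\bigcup_k F k)) ->
  forall A, measurable A -> Q A.
Proof.
move=> mG1 mG2 I1 I2 base QD Qbig.
have mbase2 B : G2 B \/ B = setT -> measurable B.
  by move=> [GB|->] //; rewrite mG2; exact: sub_gen_smallest.
have step1 A B : measurable A -> G2 B \/ B = setT -> Q (A `*` B).
  move=> mA GB; have mB := mbase2 _ GB; move: A mA; rewrite {1}mG1.
  apply: (dynkin_induction mG1) => //.
  - by apply: base => //; right.
  - by move=> A GA /=; apply: base => //; left.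
  - move=> A mA QA; have -> : (~` A) `*` B = (setT `*` B) `\` (A `*` B).
      apply/seteqP; split => -[x y] /=; first by move=> [nA By]; split => // -[].
      by move=> [[_ By] nAB]; split => // Ax; apply: nAB.
    apply: QD => //; [exact: measurableX|exact: measurableX| |].
      by move=> [x y] [].
    by apply: base => //; right.
  - move=> F mF tF QF; have -> : (\bigcup_k F k) `*` B = \bigcup_k (F k `*` B).
      by rewrite setX_bigcupl.
    apply: Qbig => //; first by move=> k; exact: measurableX.
    apply/trivIsetP => i j _ _ ij; move/trivIsetP : tF => /(_ i j Logic.I Logic.I ij) Fij.
    by rewrite -setXI Fij set0X.
have step2 A B : measurable A -> measurable B -> Q (A `*` B).
  move=> mA; move: B; rewrite {1}mG2.
  apply: (dynkin_induction mG2) => //.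
  - by apply: step1 => //; right.
  - by move=> B GB /=; apply: step1 => //; left.
  - move=> B mB QB; have -> : A `*` (~` B) = (A `*` setT) `\` (A `*` B).
      apply/seteqP; split => -[x y] /=; first by move=> [Ax nB]; split => // -[].
      by move=> [[Ax _] nAB]; split => // By; apply: nAB.
    apply: QD => //; [exact: measurableX|exact: measurableX| |].
      by move=> [x y] [].
    by apply: step1 => //; right.
  - move=> F mF tF QF; have -> : A `*` (\bigcup_k F k) = \bigcup_k (A `*` F k).
      by rewrite setX_bigcupr.
    apply: Qbig => //; first by move=> k; exact: measurableX.
    apply/trivIsetP => i j _ _ ij; move/trivIsetP : tF => /(_ i j Logic.I Logic.I ij) Fij.
    by rewrite -setXI Fij setX0.
have mprod := @measurable_prod_measurableType _ _ T1 T2.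
move=> A; rewrite {1}mprod; move: A.
apply: (dynkin_induction mprod) => //.
- move=> _ _ [A1 mA1 [B1 mB1 <-]] [A2 mA2 [B2 mB2 <-]].
  exists (A1 `&` A2); first exact: measurableI.
  by exists (B1 `&` B2); [exact: measurableI|rewrite setXI].
- by rewrite -setXTT; exact: step2.
- by move=> _ [A mA [B mB <-]]; exact: step2.
- move=> A mA QA; rewrite -setTD; apply: QD => //.
  by rewrite -setXTT; exact: step2.
Qed.

(** * Pair sums and equidistribution, block by block *)

Section BlockEstimates.
Context d (T : measurableType d) (R : realType) (P : probability T R).
Variables (J : nat -> nat) (w : nat -> R) (E : nat -> nat -> set T).
Hypothesis wE : forall n, w n = (totient n)%:R / n%:R.
Hypothesis mE : forall n j, measurable (E n j).

(** This is the [M n] of the overview; it vanishes at [n = 0], because [0^-1 = 0] makes [w 0]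
    zero. *)
Definition block (n : nat) : R := w n * \sum_(j < J n) pr P (E n j).

Lemma weight_ge0 n : 0 <= w n.
Proof. by rewrite wE divr_ge0. Qed.

Lemma block_ge0 n : 0 <= block n.
Proof.
by rewrite mulr_ge0 ?weight_ge0 // sumr_ge0 // => j _; exact: pr_ge0.
Qed.

Lemma mass_setT N : mass P J w E N setT = \sum_(n < N) block n.
Proof.
apply: eq_bigr => n _; congr (_ * _); apply: eq_bigr => j _.
by rewrite setIT.
Qed.

Let X (n k : nat) : R :=
  w n * w k * \sum_(i < J n) \sum_(j < J k) pr P (E n i `&` E k j).

(** By symmetry it is enough to sum over [k <= n], at the cost of a factor [2]. In row [n] the
    products give at most [2 * block n * S], and [sum_weight_gcd] bounds the gcd terms by
    [2 * block n]. The total [4 S^2 + 4 S] is at most [8 S^2] because [S >= 1]. *)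
Lemma pair_sum_bound N :
  (forall n k, (0 < k <= n)%N -> w n * w k *
     (\sum_(i < J n) \sum_(j < J k) pr P (E n i `&` E k j)) <=
     2 * (block n * block k) + 2 * block n * (w k * (gcdn n k)%:R ^+ 2 / n%:R ^+ 2)) ->
  1 <= \sum_(n < N) block n ->
  \sum_(n < N) \sum_(k < N) X n k <= 8 * (\sum_(n < N) block n) ^+ 2.
Proof.
move=> XB S1; set S := \sum_(n < N) block n in S1 *.
have X0 n k : 0 <= X n k.
  rewrite !mulr_ge0 ?weight_ge0 // sumr_ge0 // => i _.
  by rewrite sumr_ge0 // => j _; exact: pr_ge0.
have XC n k : X n k = X k n.
  rewrite /X [w n * _]mulrC; congr (_ * _); rewrite exchange_big /=.
  by apply: eq_bigr => j _; apply: eq_bigr => i _; rewrite setIC.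
have {}XB (n k : nat) : (k <= n)%N -> X n k <=
     2 * (block n * block k) + 2 * block n * (w k * (gcdn n k)%:R ^+ 2 / n%:R ^+ 2).
  move=> kn; have [->|k0] := posnP k; last by apply: XB; rewrite k0.
  have w00 : w 0%N = 0 by rewrite wE invr0 mulr0.
  by rewrite /X /block w00 !(mulr0, mul0r, addr0).
have half : \sum_(n < N) \sum_(k < N) X n k <= 2 * \sum_(n < N) \sum_(k < N | (k <= n)%N) X n k.
  rewrite mulr_natl mulr2n.
  under eq_bigr => n _ do rewrite (bigID (fun k : 'I_N => (k <= n)%N)) /=.
  rewrite big_split /= lerD2l (exchange_big_dep xpredT) //=.
  apply: ler_sum => k _; under eq_bigr => n _ do rewrite XC.
  rewrite big_mkcond [leRHS]big_mkcond /=; apply: ler_sum => n _.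
  by rewrite -ltnNge; case: (ltnP n k) => [/ltnW ->|_] //; case: ifP.
apply: le_trans half _.
have row (n : 'I_N) : \sum_(k < N | (k <= n)%N) X n k <= 2 * (block n * S) + 2 * block n.
  apply: le_trans (_ : \sum_(k < N | (k <= n)%N) (2 * (block n * block k) +
      2 * block n * (w k * (gcdn n k)%:R ^+ 2 / n%:R ^+ 2)) <= _).
    by apply: ler_sum => k; exact: XB.
  rewrite big_split; apply: lerD.
    rewrite -mulr_sumr ler_pM2l // -mulr_sumr ler_wpM2l ?block_ge0 //.
    rewrite [leRHS](bigID (fun k : 'I_N => (k <= n)%N)) /= lerDl.
    by apply: sumr_ge0 => k _; exact: block_ge0.
  have b0 : 0 <= 2 * block n by rewrite mulr_ge0 ?block_ge0.
  rewrite -mulr_sumr -[leRHS]mulr1 ler_wpM2l // -mulr_suml.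
  have [n0|n0] := posnP n; first by rewrite n0 expr0n invr0 mulr0.
  rewrite ler_pdivrMr ?mul1r ?exprn_gt0 ?ltr0n //.
  apply: le_trans (sum_weight_gcd _ _).
  rewrite (big_ord_widen_cond N xpredT (fun k => (totient k)%:R / k%:R * (gcdn n k)%:R ^+ 2)) //.
  rewrite [leRHS](eq_bigl (fun k : 'I_N => (k <= n)%N)) //.
  by apply: ler_sum => k _; rewrite wE.
apply: le_trans (_ : 2 * \sum_(n < N) (2 * (block n * S) + 2 * block n) <= _).
  by rewrite ler_pM2l //; apply: ler_sum => n _; exact: row.
rewrite big_split /= -!mulr_sumr -mulr_suml -/S.
have : S <= S ^+ 2 by rewrite expr2 ler_peMr //; lra.
rewrite expr2; lra.
Qed.

(** The relative error [c / n] is at most [e / 2] from [n0] on; the finitely many earlier blocks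
    contribute a constant [K0], eventually below [e / 2] times the divergent sum. *)
Lemma block_equidistributed (F : set T) (c : R) :
  (forall a : R, exists N, a <= \sum_(n < N) block n) ->
  0 <= c ->
  (forall n, (0 < n)%N ->
    `| \sum_(j < J n) pr P (E n j `&` F) - pr P F * \sum_(j < J n) pr P (E n j) | <=
    c / n%:R * \sum_(j < J n) pr P (E n j)) ->
  equidistributed P J w E F.
Proof.
move=> Sub c0 HF e e0.
have [n0 Hn0] : exists n0, (0 < n0)%N /\ c / (e / 2) <= n0%:R.
  exists (Num.truncn (c / (e / 2))).+1; split => //.
  by apply/ltW/truncnS_gt.
have diff N : `|mass P J w E N F - pr P F * mass P J w E N setT| <=
    \sum_(n < N) c / n%:R * block n.
  rewrite mass_setT /mass mulr_sumr -sumrB.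
  apply: le_trans (ler_norm_sum _ _ _) _; apply: ler_sum => n _.
  rewrite /block mulrCA -mulrBr normrM ger0_norm ?weight_ge0 // [leRHS]mulrCA.
  have [n00|n1] := posnP n; first by rewrite wE n00 invr0 mulr0 !mul0r.
  by rewrite ler_wpM2l ?weight_ge0 //; exact: HF.
have Smono M N : (M <= N)%N -> \sum_(n < M) block n <= \sum_(n < N) block n.
  move=> MN; rewrite -!(big_mkord xpredT block) [leRHS](big_cat_nat (n := M)) //=.
  by rewrite lerDl sumr_ge0 // => n _; exact: block_ge0.
set K0 := \sum_(n < n0) c / n%:R * block n.
have [N1 HN1] := Sub (K0 / (e / 2)).
have e2 : 0 < e / 2 by lra.
exists (maxn n0 N1) => N; rewrite geq_max => /andP[n0N N1N].
apply: le_trans (diff N) _; rewrite mass_setT.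
have K0S : K0 <= e / 2 * \sum_(n < N) block n.
  rewrite mulrC -ler_pdivrMr //; apply: le_trans HN1 _; exact: Smono.
rewrite -(big_mkord xpredT (fun n => c / n%:R * block n)).
rewrite (big_cat_nat (n := n0)) //= big_mkord -/K0.
apply: le_trans (_ : e / 2 * \sum_(n < N) block n + e / 2 * \sum_(n < N) block n <= _); last first.
  by rewrite -mulrDl; have -> : e / 2 + e / 2 = e by field.
apply: lerD => //.
rewrite -[X in _ <= _ * X](big_mkord xpredT block) [X in _ <= _ * X](big_cat_nat (n := n0)) //=.
rewrite mulrDr; apply: le_trans (_ : e / 2 * \sum_(n0 <= i < N) block i <= _); last first.
  by rewrite lerDr mulr_ge0 ?(ltW e2) // sumr_ge0 // => n _; exact: block_ge0.
rewrite mulr_sumr big_nat_cond [leRHS]big_nat_cond; apply: ler_sum => n /andP[/andP[n0n _] _].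
rewrite ler_wpM2r ?block_ge0 //.
have n1 : (0 : R) < n%:R by rewrite ltr0n (leq_trans Hn0.1).
rewrite ler_pdivrMr // mulrC -ler_pdivrMr //; apply: le_trans Hn0.2 _.
by rewrite ler_nat.
Qed.

End BlockEstimates.

Arguments block {d T R} P J w E n.

(** * Strips on the torus *)

(** Integer coefficients make the linear form well defined modulo 1 on the torus. *)
Lemma frac_rot_form (R : realType) (a b : nat) (u v z : R) :
  frac (a%:R * frac u + b%:R * frac v - z) = frac (a%:R * u + b%:R * v - z).
Proof.
rewrite -(fracDz _ (a%:R * u + b%:R * v - z) (- (a%:Z * Num.floor u + b%:Z * Num.floor v))).
by congr (frac _); rewrite /frac rmorphN rmorphD !rmorphM /= !pmulrn; ring.
Qed.

Section Strips.
Variable R : realType.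
Local Notation TR := (measurableTypeR R).
Local Notation prU := (pr (unif2 R)).

(** The condition is one-sided: it bounds the fractional part, not the distance to the nearest
    integer. For a nonzero form the measure is then exactly [eta] up to [eta = 1], and the strip
    lies inside the two-sided neighbourhood of radius [eta], which suffices for a lower bound. *)
Definition strip (a b : nat) (z eta : R) : set (TR * TR) :=
  [set x | frac (a%:R * x.1 + b%:R * x.2 - z) < eta].

Lemma measurable_strip a b z eta : measurable (strip a b z eta).
Proof.
have mf : measurable_fun setT
    (fun x : TR * TR => a%:R * x.1 + b%:R * x.2 - z : TR).
  apply: measurable_funB; last exact: measurable_cst.
  by apply: measurable_funD; apply: measurable_funM;
    [exact: measurable_cst|exact: measurable_fst|exact: measurable_cst|exact: measurable_snd].
have mg : measurable_fun setT
    (fun x : TR * TR => frac (a%:R * x.1 + b%:R * x.2 - z : R) : TR).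
  exact: (measurableT_comp (measurable_frac R) mf).
rewrite (_ : strip a b z eta =
    (fun x : TR * TR => frac (a%:R * x.1 + b%:R * x.2 - z : R) : TR) @^-1` `]-oo, eta[).
  by rewrite -[X in measurable X]setTI; apply: mg => //; exact: measurable_itv.
by apply/seteqP; split => x /=; rewrite in_itv.
Qed.

Definition shift (s : R * R) (M i : nat) : TR * TR -> TR * TR :=
  rot2 (i%:R / M%:R * s.1, i%:R / M%:R * s.2).

Definition shift_inv (s : R * R) (M : nat) (A : set (TR * TR)) :=
  forall i, shift s M i @^-1` A = A.

Lemma strip_shift a b z eta (s : R * R) M i x :
  strip a b z eta (shift s M i x) <->
  frac (a%:R * x.1 + b%:R * x.2 - z + i%:R / M%:R * (a%:R * s.1 + b%:R * s.2)) < eta.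
Proof.
rewrite /strip /shift /rot2 /rot /= frac_rot_form.
set u := (X in frac X < _); set v := (X in _ <-> frac X < _).
by have -> : u = v by rewrite /u /v; ring.
Qed.

Lemma shift_invI s M A B : shift_inv s M A -> shift_inv s M B -> shift_inv s M (A `&` B).
Proof. by move=> hA hB i; rewrite preimage_setI hA hB. Qed.

Lemma strip_shift_inv a b z eta s M (m : int) :
  a%:R * s.1 + b%:R * s.2 = m%:~R * M%:R -> shift_inv s M (strip a b z eta).
Proof.
move=> sE i; apply/seteqP; split => x /=; rewrite strip_shift sE.
(* Translation by [i s / M] changes the form by the integer [i m]; for [M = 0] the quotient is [0]
   by convention, and so is the change. *)
all: suff -> : i%:R / M%:R * (m%:~R * M%:R) =
  ((if M == 0 then 0 else i%:Z * m)%:~R : R) by rewrite fracDz.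
all: case: eqP => [->|/eqP M0]; first by rewrite !mulr0.
all: by rewrite rmorphM /= -pmulrn mulrCA divfK ?pnatr_eq0 // mulrC.
Qed.

(** Along an orbit the form advances in steps of [c / M], so [count_frac] controls the number of
    visits to the strip from every starting point. *)
Lemma pr_strip_average M s A a b (c : nat) z eta :
  (0 < M)%N -> 0 <= eta <= 1 -> measurable A -> shift_inv s M A ->
  a%:R * s.1 + b%:R * s.2 = c%:R ->
  `| prU (A `&` strip a b z eta) - eta * prU A | <= (gcdn c M)%:R / M%:R * prU A.
Proof.
move=> M0 eta01 mA iA sE.
apply: (pr_orbit_average _ _ _ _ _ (shift s M)) => //.
- exact: measurable_strip.
- move=> i D mD; rewrite -[X in measurable X]setTI; apply: measurable_rot2 => //.
- by move=> i D mD; exact: unif2_rot.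
move=> x _; rewrite (eq_bigr (fun i : 'I_M =>
  ((frac (a%:R * x.1 + b%:R * x.2 - z + c%:R * i%:R / M%:R) < eta)%R%:R : R))).
  exact: count_frac.
move=> i _; rewrite indicE; congr (nat_of_bool _)%:R.
have iE : i%:R / M%:R * c%:R = c%:R * i%:R / M%:R :> R by rewrite mulrC mulrA.
by apply/idP/idP => [/set_mem|h]; [|apply/mem_set]; rewrite strip_shift sE iE.
Qed.

(** With [M = c K] the gcd in [pr_strip_average] is [c], so that the error is at most [1 / K], and
    [K] is arbitrary. *)
Lemma pr_strip_exact s A a b (c : nat) z eta :
  (0 < c)%N -> 0 <= eta <= 1 -> measurable A ->
  (forall K, (0 < K)%N -> shift_inv s (c * K) A) ->
  a%:R * s.1 + b%:R * s.2 = c%:R ->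
  prU (A `&` strip a b z eta) = eta * prU A.
Proof.
move=> c0 eta01 mA iA sE; apply/eqP; rewrite -subr_eq0 -normr_le0.
apply/ler_addgt0Pr => e e0; rewrite add0r.
pose K := (Num.truncn e^-1).+1.
have Ke : e^-1 < K%:R by exact: truncnS_gt.
have K0 : (0 : R) < K%:R by rewrite ltr0n.
have M0 : (0 < c * K)%N by rewrite muln_gt0 c0.
apply: le_trans (pr_strip_average _ _ _ _ _ _ z eta M0 eta01 mA (iA K _) sE) _ => //.
have -> : gcdn c (c * K) = c by apply/gcdn_idPl/dvdn_mulr.
have cr : (0 : R) < c%:R by rewrite ltr0n.
rewrite natrM invfM mulrA divff ?lt0r_neq0 // mul1r.
apply: le_trans (_ : K%:R^-1 * 1 <= _).
  by rewrite ler_wpM2l ?invr_ge0 // -(pr_setT _ _ _ (unif2 R)); apply: pr_le.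
by rewrite mulr1 invf_ple ?posrE // ltW.
Qed.

Lemma pr_strip_b a b z eta : (0 < b)%N -> 0 <= eta <= 1 -> prU (strip a b z eta) = eta.
Proof.
move=> b0 eta01; rewrite -[strip _ _ _ _]setTI (pr_strip_exact (0, 1) _ _ _ b) //.
- by rewrite pr_setT mulr1.
- by rewrite /= mulr0 mulr1 add0r.
Qed.

Lemma pr_strip_a a z eta : (0 < a)%N -> 0 <= eta <= 1 -> prU (strip a 0 z eta) = eta.
Proof.
move=> a0 eta01; rewrite -[strip _ _ _ _]setTI (pr_strip_exact (1, 0) _ _ _ a) //.
- by rewrite pr_setT mulr1.
- by rewrite /= mulr0 mulr1 addr0.
Qed.

Lemma vertical_inv0 a z eta M : shift_inv (0, 1) M (strip a 0 z eta).
Proof. by apply: (strip_shift_inv _ _ _ _ _ _ 0) => /=; rewrite mulr0 !mul0r addr0. Qed.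

Lemma vertical_inv a b z eta : shift_inv (0, 1) b (strip a b z eta).
Proof. by apply: (strip_shift_inv _ _ _ _ _ _ 1) => /=; rewrite mulr0 mulr1 mul1r add0r. Qed.

Lemma horizontal_inv a z eta : shift_inv (1, 0) a (strip a 0 z eta).
Proof. by apply: (strip_shift_inv _ _ _ _ _ _ 1) => /=; rewrite mulr0 mulr1 mul1r addr0. Qed.

Lemma pr_arc_rectangle a a' d d' : 0 <= d <= 1 -> 0 <= d' <= 1 ->
  prU (strip 1 0 a d `&` strip 0 1 a' d') = d * d'.
Proof.
move=> d01 d'01; rewrite (pr_strip_exact (0, 1) _ _ _ 1) //.
- by rewrite pr_strip_a // mulrC.
- exact: measurable_strip.
- by move=> K _; exact: vertical_inv0.
- by rewrite /= mulr1 mulr0 add0r.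
Qed.

(* Only vertical translations are used, so the two forms may be parallel. *)
Lemma pr_stripI_le a b z eta k l y zeta :
  (0 < b)%N -> 0 <= eta <= 1 -> 0 <= zeta <= 1 ->
  prU (strip a b z eta `&` strip l k y zeta) <= (zeta + (gcdn b k)%:R / b%:R) * eta.
Proof.
move=> b0 e01 z01.
have sE : l%:R * ((0, 1) : R * R).1 + k%:R * ((0, 1) : R * R).2 = k%:R :> R
  by rewrite /= mulr0 mulr1 add0r.
have := pr_strip_average _ _ _ _ _ _ y zeta b0 z01 (measurable_strip a b z eta)
  (vertical_inv _ _ _ _) sE.
rewrite pr_strip_b // gcdnC ler_distl => /andP[_]; lra.
Qed.

(* Average over translations in the kernel of the first form. *)
Lemma pr_stripI_indep j n y eta l k zeta y' :
  (0 < n)%N -> (n * l != j * k)%N -> 0 <= eta <= 1 -> 0 <= zeta <= 1 ->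
  prU (strip j n y eta `&` strip l k y' zeta) = zeta * eta.
Proof.
move=> n0 njk e01 z01.
have [s [c [c0 sE sE']]] : exists s : R * R, exists c : nat,
    [/\ (0 < c)%N, l%:R * s.1 + k%:R * s.2 = c%:R & j%:R * s.1 + n%:R * s.2 = 0].
  (* The kernel of the first form is spanned by [(- n, j)]; the sign is chosen so that the second
     form takes a positive value [c] there. *)
  move: njk; rewrite neq_ltn => /orP[lt|lt].
    exists (- n%:R, j%:R), (j * k - n * l)%N; split => /=; first by rewrite subn_gt0.
      by rewrite natrB ?(ltnW lt) // !natrM; ring.
    by ring.
  exists (n%:R, - j%:R), (n * l - j * k)%N; split => /=; first by rewrite subn_gt0.
    by rewrite natrB ?(ltnW lt) // !natrM; ring.
  by ring.
rewrite (pr_strip_exact s _ _ _ c) ?pr_strip_b //; first exact: measurable_strip.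
move=> K K0; apply: (strip_shift_inv _ _ _ _ _ _ 0); first by rewrite sE' mul0r.
Qed.

(** The arc in the first coordinate is exactly independent of the strip, by vertical translations.
    For the arc in the second, the vertical translations by [i / n] preserve the strip and move the
    coordinate in steps of [1 / n]; hence the error. *)
Lemma strip_rectangle_discrepancy j n y eta a a' d d' :
  (0 < n)%N -> 0 <= eta <= 1 -> 0 <= d <= 1 -> 0 <= d' <= 1 ->
  `| prU (strip j n y eta `&` (strip 1 0 a d `&` strip 0 1 a' d')) - d * d' * eta |
    <= n%:R^-1 * eta.
Proof.
move=> n0 e01 d01 d'01; rewrite setIA.
set A := strip j n y eta `&` strip 1 0 a d.
have mA : measurable A by apply: measurableI; exact: measurable_strip.
have prA : prU A = eta * d.
  rewrite /A setIC (pr_strip_exact (0, 1) _ _ _ n) ?pr_strip_a //.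
  - exact: measurable_strip.
  - by move=> K _; exact: vertical_inv0.
  - by rewrite /= mulr0 mulr1 add0r.
have iA : shift_inv (0, 1) n A by apply: shift_invI; [exact: vertical_inv|exact: vertical_inv0].
have sE : 0%:R * ((0, 1) : R * R).1 + 1%:R * ((0, 1) : R * R).2 = 1%:R :> R
  by rewrite /= mulr0 mulr1 add0r.
have := pr_strip_average _ _ _ _ _ _ a' d' n0 d'01 mA iA sE.
rewrite gcd1n prA mul1r => h.
rewrite [d * d' * eta](_ : _ = d' * (eta * d)); last by ring.
apply: le_trans h _.
have ninv : 0 <= n%:R^-1 :> R by rewrite invr_ge0.
by rewrite ler_wpM2l //; case/andP: e01 => e0 e1; rewrite ler_piMr //; case/andP: d01.
Qed.

Definition box (n : nat) (y : R * R) (eta : R) : set (TR * TR) :=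
  strip n 0 y.1 eta `&` strip 0 n y.2 eta.

Lemma measurable_box n y eta : measurable (box n y eta).
Proof. by apply: measurableI; exact: measurable_strip. Qed.

Lemma pr_box n y eta : (0 < n)%N -> 0 <= eta <= 1 -> prU (box n y eta) = eta ^+ 2.
Proof.
move=> n0 e01; rewrite /box (pr_strip_exact (0, 1) _ _ _ n) ?pr_strip_a ?expr2 //.
- exact: measurable_strip.
- by move=> K _; exact: vertical_inv0.
- by rewrite /= mulr0 mulr1 add0r.
Qed.

(** The four strips are regrouped by coordinate. Horizontal translations by [i / n] treat the two
    conditions on [x.1]. Vertical ones give the factor [eta] exactly, then a factor at most
    [zeta + gcdn n k / n] for the last condition. *)
Lemma pr_boxI_le n k y eta zeta : (0 < n)%N -> (0 < k)%N ->
  0 <= eta <= 1 -> 0 <= zeta <= 1 ->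
  prU (box n y eta `&` box k y zeta) <= ((zeta + (gcdn n k)%:R / n%:R) * eta) ^+ 2.
Proof.
move=> n0 k0 e01 z01; set g := (gcdn n k)%:R / n%:R.
have nr : (0 : R) < n%:R by rewrite ltr0n.
have g0 : 0 <= g by rewrite divr_ge0.
rewrite /box setIACA.
set A := strip n 0 _ _ `&` strip k 0 _ _.
have mA : measurable A by apply: measurableI; exact: measurable_strip.
have hA : prU A <= (zeta + g) * eta.
  have sE : k%:R * ((1, 0) : R * R).1 + 0%:R * ((1, 0) : R * R).2 = k%:R :> R
    by rewrite /= mulr0 mulr1 addr0.
  have := pr_strip_average _ _ _ _ _ _ y.1 zeta n0 z01 (measurable_strip n 0 y.1 eta)
    (horizontal_inv _ _ _) sE.
  rewrite pr_strip_a // gcdnC ler_distl => /andP[_]; rewrite -/g -/A; lra.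
rewrite setIA; set B := A `&` _.
have mB : measurable B by apply: measurableI => //; exact: measurable_strip.
have iA M : shift_inv (0, 1) M A by apply: shift_invI; exact: vertical_inv0.
have prB : prU B = eta * prU A.
  rewrite /B (pr_strip_exact (0, 1) _ _ _ n) //.
  by rewrite /= mulr0 mulr1 add0r.
have iB : shift_inv (0, 1) n B by apply: shift_invI => //; exact: vertical_inv.
have sE : 0%:R * ((0, 1) : R * R).1 + k%:R * ((0, 1) : R * R).2 = k%:R :> R
  by rewrite /= mulr0 mulr1 add0r.
have := pr_strip_average _ _ _ _ _ _ y.2 zeta n0 z01 mB iB sE.
rewrite gcdnC -/g prB ler_distl => /andP[_ h].
apply: le_trans h _; rewrite -mulrDl mulrA expr2 ler_wpM2l //.
by case/andP: e01 => e0 _; case/andP: z01 => z0 _; rewrite mulr_ge0 // addr_ge0.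
Qed.

Lemma box_rectangle_discrepancy n y eta a a' d d' :
  (0 < n)%N -> 0 <= eta <= 1 -> 0 <= d <= 1 -> 0 <= d' <= 1 ->
  `| prU (box n y eta `&` (strip 1 0 a d `&` strip 0 1 a' d')) - d * d' * eta ^+ 2 |
    <= 3 / n%:R * eta ^+ 2.
Proof.
move=> n0 e01 d01 d'01; set g := n%:R^-1 : R.
have nr : (1 : R) <= n%:R by rewrite ler1n.
have g0 : 0 <= g by rewrite invr_ge0.
have g1 : g <= 1 by rewrite invf_le1 // ltr0n.
rewrite /box setIACA.
set A := strip n 0 _ _ `&` strip 1 0 _ _.
have mA : measurable A by apply: measurableI; exact: measurable_strip.
have hA : `|prU A - d * eta| <= g * eta.
  have sE : 1%:R * ((1, 0) : R * R).1 + 0%:R * ((1, 0) : R * R).2 = 1%:R :> R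
    by rewrite /= mulr0 mulr1 addr0.
  have := pr_strip_average _ _ _ _ _ _ a d n0 d01 (measurable_strip n 0 y.1 eta)
    (horizontal_inv _ _ _) sE.
  by rewrite pr_strip_a // gcd1n mul1r.
rewrite setIA; set B := A `&` _.
have mB : measurable B by apply: measurableI => //; exact: measurable_strip.
have iA M : shift_inv (0, 1) M A by apply: shift_invI; exact: vertical_inv0.
have prB : prU B = eta * prU A.
  rewrite /B (pr_strip_exact (0, 1) _ _ _ n) //.
  by rewrite /= mulr0 mulr1 add0r.
have iB : shift_inv (0, 1) n B by apply: shift_invI => //; exact: vertical_inv.
have sE : 0%:R * ((0, 1) : R * R).1 + 1%:R * ((0, 1) : R * R).2 = 1%:R :> R
  by rewrite /= mulr0 mulr1 add0r.
have := pr_strip_average _ _ _ _ _ _ a' d' n0 d'01 mB iB sE.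
rewrite gcd1n mul1r -/g prB => h.
set p := prU A in hA h; set q := prU _ in h *.
case/andP: e01 d01 d'01 => e0 e1 /andP[d0 d1] /andP[d'0 d'1].
(* The constant [3]: replacing the second arc by its length costs [g * (eta * p) <= 2 g eta^2], and
   replacing [p] by [d * eta] costs at most [g eta^2]. *)
have p2 : p <= 2 * eta by move: hA; rewrite ler_distl => /andP[_]; nra.
have -> : q - d * d' * eta ^+ 2 = (q - d' * (eta * p)) + d' * eta * (p - d * eta) by ring.
apply: le_trans (ler_normD _ _) _.
rewrite [`|_ * (p - _)|]normrM (ger0_norm (mulr_ge0 d'0 e0)).
apply: le_trans (_ : g * (eta * (2 * eta)) + 1 * eta * (g * eta) <= _).
  apply: lerD.
    by apply: le_trans h _; rewrite ler_wpM2l // ler_wpM2l.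
  by rewrite ler_pM // ?mulr_ge0 // ler_wpM2r.
have -> : g * (eta * (2 * eta)) + 1 * eta * (g * eta) = 3 * g * eta ^+ 2 by ring.
exact: lexx.
Qed.

End Strips.

Arguments strip {R} a b z eta.
Arguments box {R} n y eta.

(** * Full measure on the torus *)

Lemma finite_set_bounded (I : choiceType) (A : set I) (f : I -> nat) :
  finite_set A -> exists K, forall i, A i -> (f i < K)%N.
Proof.
move=> /finite_seqP[s ->]; exists (\max_(i <- s) f i).+1 => i /= is_.
by rewrite ltnS; exact: leq_bigmax_seq.
Qed.

(** A set of indices is infinite exactly when its codes under [pickle] are unbounded, which yields a
    countable intersection of countable unions. *)
Lemma measurable_infinitely_often d (T : measurableType d) (I : countType)
    (U : I -> set T) : (forall i, measurable (U i)) ->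
  measurable [set x | infinite_set [set i | U i x]].
Proof.
move=> mU; pose V m := if (pickle_inv m : option I) is Some i then U i else set0.
have mV m : measurable (V m) by rewrite /V; case: (pickle_inv m).
rewrite (_ : [set x | _] = \bigcap_k \bigcup_(m in [set m | (k <= m)%N]) V m).
  by apply: bigcapT_measurable => k; apply: bigcup_measurable => m _.
apply/seteqP; split => x /=.
  move=> inf k _; apply: contrapT => noV; apply: inf.
  apply: (@sub_finite_set _ _ (pickle @^-1` `I_k)); last first.
    by apply: finite_preimage; [move=> i j _ _; exact: (pcan_inj pickleK)|exact: finite_II].
  move=> i Ui /=; rewrite ltnNge; apply/negP => ki; apply: noV.
  by exists (pickle i) => //; rewrite /V pickleK_inv.
move=> h /(@finite_set_bounded _ _ pickle)[K HK].
have [m /= Km] := h K Logic.I; have := @pickle_invK I m; rewrite /V.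
case: (pickle_inv m) => [i|] //= im Ui; have := HK i Ui.
by rewrite im ltnNge Km.
Qed.

Lemma unif2_restriction (R : realType) (A : set (measurableTypeR R * measurableTypeR R)) :
  measurable A ->
  unif2 R A = (@lebesgue_measure R \x @lebesgue_measure R)%E
    (A `&` `[0%R, 1%R[ `*` `[0%R, 1%R[).
Proof.
move=> mA.
have mI : measurable (`[0%R, 1%R[ : set (measurableTypeR R)) by exact: measurable_itv.
have mII := measurableX mI mI.
pose m' := mrestr (@lebesgue_measure R \x @lebesgue_measure R)%E mII.
rewrite -[RHS]/(m' A); apply: product_measure_unique => //= B C mB mC.
rewrite /m' /mrestr -setXI product_measure1E //; exact: measurableI.
Qed.

Lemma unif2_eq (R : realType) (A B : set (measurableTypeR R * measurableTypeR R)) :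
  measurable A -> measurable B ->
  (forall x, 0 <= x.1 < 1 -> 0 <= x.2 < 1 -> A x <-> B x) ->
  unif2 R A = unif2 R B.
Proof.
move=> mA mB AB; rewrite !unif2_restriction //; congr (_ _).
apply/seteqP; split => x [] h [] /=; rewrite !in_itv /= => x1 x2;
  by split => //=; rewrite ?in_itv //=; apply/AB.
Qed.

(** The measure of [A] is at most that of the closed square and at least that of [L] within the
    half-open one, both equal to [1]. *)
Lemma lebesgue2_full (R : realType) (A L : set (measurableTypeR R * measurableTypeR R)) :
  measurable A -> measurable L -> unif2 R L = 1%E ->
  (forall x, A x -> 0 <= x.1 <= 1 /\ 0 <= x.2 <= 1) ->
  (forall x, 0 <= x.1 < 1 -> 0 <= x.2 < 1 -> L x -> A x) ->
  ((@lebesgue_measure R \x @lebesgue_measure R) A = 1)%E.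
Proof.
move=> mA mL L1 Asub LA; apply/eqP; rewrite eq_le; apply/andP; split.
  have mJ : measurable (`[0%R, 1%R] : set (measurableTypeR R)) by exact: measurable_itv.
  apply: le_trans (_ : ((@lebesgue_measure R \x @lebesgue_measure R)
      (`[0%R, 1%R] `*` `[0%R, 1%R])%classic <= _)%E).
    by apply: le_measure; rewrite ?inE //; exact: measurableX.
  have J1 : @lebesgue_measure R `[0%R, 1%R] = 1%E.
    by rewrite lebesgue_measure_itv /= lte_fin ltr01 oppr0 addr0.
  have := @product_measure1E _ _ _ _ R lebesgue_measure lebesgue_measure _ _ mJ mJ.
  by rewrite [X in _ = (X * _)%E]J1 mul1e => ->; rewrite [leLHS]J1.
have mI : measurable (`[0%R, 1%R[ : set (measurableTypeR R)) by exact: measurable_itv.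
have mII := measurableX mI mI.
rewrite -L1 unif2_restriction //; apply: le_measure; rewrite ?inE //.
  exact: measurableI.
move=> x [Lx []] /=; rewrite !in_itv /= => x1 x2; exact: LA.
Qed.

(** The rays [[a, +oo[] generate the Borel sets. Within [[0, 1[] such a ray is everything, nothing
    or [[a, 1[], always an arc of the circle, hence a strip condition on one coordinate. *)
Lemma ray_is_arc (R : realType) (A : set (measurableTypeR R)) :
  @RGenCInfty.G R A \/ A = setT ->
  measurable A /\ exists a d : R, 0 <= d <= 1 /\
    forall x, 0 <= x < 1 -> A x <-> frac (x - a) < d.
Proof.
move=> [[a ->]|->]; last first.
  by split => //; exists 0, 1; split; [rewrite ler01 lexx|move=> x _; split => // _; exact: frac_lt1].
split; first exact: measurable_itv.
have [a0|a0] := leP a 0.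
  exists 0, 1; split; first by rewrite ler01 lexx.
  move=> x /andP[x0 x1]; rewrite /= in_itv /= andbT; split => _; first exact: frac_lt1.
  exact: le_trans a0 x0.
have [a1|a1] := ltP a 1; last first.
  exists 0, 0; split; first by rewrite ler01 lexx.
  move=> x /andP[x0 x1]; rewrite /= in_itv /= andbT; split => h; first lra.
  by have := frac_ge0 _ (x - 0); rewrite leNgt h.
exists a, (1 - a); split; first by apply/andP; split; lra.
move=> x /andP[x0 x1]; rewrite /= in_itv /= andbT; split => h.
  by rewrite frac_id; [lra|apply/andP; split; lra].
rewrite leNgt; apply/negP => xa; move: h.
(* For [0 <= x < a] the point [x - a] lies in [[-1, 0[], and its fractional part [x - a + 1] is at
   least [1 - a]. *)
rewrite (@frac_def _ _ (- 1)); first by rewrite rmorphN /=; lra.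
by rewrite rmorphN /=; apply/andP; split; lra.
Qed.

Section FullMeasure.
Variables (R : realType) (J : nat -> nat) (w : nat -> R).
Variable E : nat -> nat -> set (measurableTypeR R * measurableTypeR R).
Local Notation prU := (pr (unif2 R)).
Local Notation M := (block (unif2 R) J w E).

(** The discrepancy on rectangles of arcs gives equidistribution on products of rays, the pair
    estimate gives L^2-boundedness with constant [8], and [dynkin_rectangles] extends
    equidistribution to all measurable sets. *)
Lemma unif2_limsup_sets (c : R) :
  (forall n, w n = (totient n)%:R / n%:R) ->
  (forall n j, measurable (E n j)) ->
  (forall a : R, exists N, a <= \sum_(n < N) M n) ->
  (forall n k, (0 < k <= n)%N -> w n * w k *
     (\sum_(i < J n) \sum_(j < J k) prU (E n i `&` E k j)) <=
     2 * (M n * M k) + 2 * M n * (w k * (gcdn n k)%:R ^+ 2 / n%:R ^+ 2)) ->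
  0 <= c ->
  (forall n a a' d d', (0 < n)%N -> 0 <= d <= 1 -> 0 <= d' <= 1 ->
     `| \sum_(j < J n) prU (E n j `&` (strip 1 0 a d `&` strip 0 1 a' d')) -
        d * d' * \sum_(j < J n) prU (E n j) | <= c / n%:R * \sum_(j < J n) prU (E n j)) ->
  unif2 R (limsup_sets J E) = 1%E.
Proof.
move=> wE mE Sub XB c0 disc.
have w0 n : 0 <= w n by rewrite wE divr_ge0.
have Sub' a : exists N, a <= mass (unif2 R) J w E N setT.
  by have [N aN] := Sub a; exists N; rewrite mass_setT.
have pairs N : 1 <= mass (unif2 R) J w E N setT ->
    \sum_(n < N) \sum_(k < N) w n * w k *
      \sum_(i < J n) \sum_(j < J k) prU (E n i `&` E k j) <=
    8 * mass (unif2 R) J w E N setT ^+ 2.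
  by rewrite mass_setT; exact: pair_sum_bound.
have C0 : 0 < 8 :> R by [].
apply: (pr_limsup_sets _ _ _ _ J w E) => //.
apply: (dynkin_rectangles _ _ _ _ (@RGenCInfty.G R) (@RGenCInfty.G R)).
- exact: RGenCInfty.measurableE.
- exact: RGenCInfty.measurableE.
- move=> _ _ [a ->] [b ->]; exists (Num.max a b).
  by apply/seteqP; split => x /=; rewrite !in_itv /= !andbT ge_max => /andP.
- move=> _ _ [a ->] [b ->]; exists (Num.max a b).
  by apply/seteqP; split => x /=; rewrite !in_itv /= !andbT ge_max => /andP.
- move=> A B /ray_is_arc[mA [a [d [d01 AE]]]] /ray_is_arc[mB [a' [d' [d'01 BE]]]].
  have rectE x : 0 <= x.1 < 1 -> 0 <= x.2 < 1 ->
      (A `*` B) x <-> (strip 1 0 a d `&` strip 0 1 a' d') x.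
    move=> x1 x2; rewrite /strip /= !mul1r !mul0r add0r addr0.
    by split => -[h1 h2]; split; by [apply/AE|apply/BE].
  have mrect : measurable (strip 1 0 a d `&` strip 0 1 a' d').
    by apply: measurableI; exact: measurable_strip.
  have mAB : measurable (A `*` B) by exact: measurableX.
  apply: (block_equidistributed _ _ _ _ _ _ _ wE _ c) => // n n0.
  have -> : prU (A `*` B) = d * d'.
    by rewrite -(pr_arc_rectangle _ a a' d d') //; congr fine; exact: unif2_eq.
  rewrite (eq_bigr (fun j : 'I_(J n) =>
    prU (E n j `&` (strip 1 0 a d `&` strip 0 1 a' d')))); first exact: disc.
  move=> j _; congr fine; apply: unif2_eq.
  + exact: measurableI.
  + exact: measurableI.
  + by move=> x x1 x2; split => -[h1 h2]; split => //; apply/rectE.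
- by move=> F G mF mG FG eF eG; exact: equidistributedD.
- by move=> F mF tF eF; exact: (equidistributed_bigcup _ _ _ _ _ _ _ 8).
Qed.

End FullMeasure.

(** If the partial sums of [v] stayed below [a], those of [u] would stay below [a] plus the fixed
    sum of the first [n0] terms. *)
Lemma unbounded_sum (R : realType) (u v : nat -> R) (n0 : nat) :
  (forall n, 0 <= u n) -> (forall n, 0 <= v n) ->
  (forall n, (n0 <= n)%N -> u n <= v n) ->
  (\sum_(1 <= q <oo) (u q)%:E = +oo)%E ->
  forall a, exists N, a <= \sum_(n < N) v n.
Proof.
move=> u0 v0 uv uoo a; apply: contrapT => noN.
pose b := \sum_(n < n0) u n.
have vlt N : \sum_(n < N) v n < a.
  by rewrite ltNge; apply/negP => h; apply: noN; exists N.
have part N : \sum_(n < N) u n <= b + \sum_(n < N) v n.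
  have [Nn|nN] := leqP N n0.
    apply: le_trans (_ : b <= _); last by rewrite lerDl sumr_ge0.
    rewrite /b -!(big_mkord xpredT u) [leRHS](big_cat_nat (n := N)) //=.
    by rewrite lerDl sumr_ge0.
  rewrite -!(big_mkord xpredT) (big_cat_nat (n := n0)) ?(ltnW nN) //= /b -(big_mkord xpredT u).
  rewrite lerD2l [leRHS](big_cat_nat (n := n0)) ?(ltnW nN) //=.
  apply: le_trans (_ : \sum_(n0 <= i < N) v i <= _); last by rewrite lerDr sumr_ge0.
  by rewrite big_nat_cond [leRHS]big_nat_cond; apply: ler_sum => i /andP[/andP[? _] _]; exact: uv.
have : ((\sum_(1 <= q <oo) (u q)%:E) <= (b + a)%:E)%E.
  apply: lime_le; first by apply: is_cvg_nneseries => n _ _; rewrite lee_fin.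
  apply: nearW => N; rewrite sumEFin lee_fin.
  apply: le_trans (_ : \sum_(0 <= i < N) u i <= _).
    case: N => [|N]; first by rewrite !big_geq.
    by rewrite [leRHS]big_ltn // lerDr.
  rewrite big_mkord; apply: le_trans (part N) _.
  by rewrite lerD2l ltW.
by rewrite uoo.
Qed.

(** As [totient q <= q], an exponent above [1] only decreases the weight, so the assumed divergence
    passes to the weights with exponent [1]. *)
Lemma weight_powR_le (R : realType) (eps : R) (q : nat) : 0 < eps ->
  ((totient q)%:R / q%:R) `^ (1 + eps) <= (totient q)%:R / q%:R :> R.
Proof.
move=> e0; have [->|q0] := posnP q.
  by rewrite invr0 mulr0 powR0 // lt0r_neq0 //; lra.
have qr : (0 : R) < q%:R by rewrite ltr0n.
have t0 : (0 : R) < (totient q)%:R / q%:R by rewrite divr_gt0 // ltr0n totient_gt0.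
have t1 : (totient q)%:R / q%:R <= 1 :> R.
  rewrite ler_pdivrMr // mul1r ler_nat.
  by have := totient_dvd_le 1 q q0 (dvd1n q); rewrite muln1 mul1n.
rewrite -[leRHS]powRr1 ?(ltW t0) //; apply: ger_powR; first by rewrite t0.
by rewrite lerDl ltW.
Qed.

(** * Approximable points *)

Section ApproximableSets.
Variable R : realType.
Local Notation TR := (measurableTypeR R).

Lemma measurable_affine (a b c : R) :
  measurable_fun setT (fun x : TR * TR => a * x.1 + b * x.2 + c : TR).
Proof.
apply: measurable_funD; last exact: measurable_cst.
by apply: measurable_funD; apply: measurable_funM;
  [exact: measurable_cst|exact: measurable_fst|exact: measurable_cst|exact: measurable_snd].
Qed.

Lemma measurable_affine_norm_lt (a b c r : R) :
  measurable ([set x | `|a * x.1 + b * x.2 + c| < r] : set (TR * TR)).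
Proof.
rewrite (_ : [set x | _] =
    (fun x : TR * TR => a * x.1 + b * x.2 + c : TR) @^-1` `]- r, r[).
  by rewrite -[X in measurable X]setTI; apply: measurable_affine => //; exact: measurable_itv.
by apply/seteqP; split => x /=; rewrite in_itv /= ltr_norml.
Qed.

Lemma measurable_closed_square :
  measurable ([set x | 0 <= x.1 <= 1 /\ 0 <= x.2 <= 1] : set (TR * TR)).
Proof.
rewrite (_ : [set x | _] = `[0%R, 1%R]%classic `*` `[0%R, 1%R]%classic).
  by apply: measurableX; exact: measurable_itv.
by apply/seteqP; split => x /=; rewrite !in_itv.
Qed.

Lemma measurable_A21 (psi : nat -> R) (y : R) :
  measurable (A21 psi y : set (TR * TR)).
Proof.
pose U (pq : int * (int * int)) : set (TR * TR) :=
  if pq.2 != (0%Z, 0%Z) then [set x | `| pq.2.1%:~R * x.1 + pq.2.2%:~R * x.2 +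
    (pq.1%:~R - y) | < psi (maxn `|pq.2.1|%N `|pq.2.2|%N)] else set0.
have mU pq : measurable (U pq).
  by rewrite /U; case: ifP => // _; exact: measurable_affine_norm_lt.
rewrite (_ : A21 psi y = [set x | 0 <= x.1 <= 1 /\ 0 <= x.2 <= 1] `&`
    [set x | infinite_set [set pq | U pq x]]).
  by apply: measurableI; [exact: measurable_closed_square|exact: measurable_infinitely_often].
have UE x : [set pq | U pq x] = [set pq : int * (int * int) |
      pq.2 != (0%Z, 0%Z) /\
      `| pq.2.1%:~R * x.1 + pq.2.2%:~R * x.2 + pq.1%:~R - y |
        < psi (maxn `|pq.2.1|%N `|pq.2.2|%N)].
  by apply/seteqP; split => pq; rewrite /U /= -addrA; case: ifP => // _ [].
by apply/seteqP; split => x; rewrite /A21 /= UE; tauto.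
Qed.

Lemma measurable_A12 (psi : nat -> R) (y : R * R) :
  measurable (A12 psi y : set (TR * TR)).
Proof.
pose U (pq : (int * int) * int) : set (TR * TR) :=
  if pq.2 != 0%Z then
    [set x | `| pq.2%:~R * x.1 + 0 * x.2 + (pq.1.1%:~R - y.1) | < psi `|pq.2|%N] `&`
    [set x | `| 0 * x.1 + pq.2%:~R * x.2 + (pq.1.2%:~R - y.2) | < psi `|pq.2|%N]
  else set0.
have mU pq : measurable (U pq).
  rewrite /U; case: ifP => // _.
  by apply: measurableI; exact: measurable_affine_norm_lt.
rewrite (_ : A12 psi y = [set x | 0 <= x.1 <= 1 /\ 0 <= x.2 <= 1] `&`
    [set x | infinite_set [set pq | U pq x]]).
  by apply: measurableI; [exact: measurable_closed_square|exact: measurable_infinitely_often].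
have UE x : [set pq | U pq x] = [set pq : (int * int) * int |
      pq.2 != 0%Z /\
      Num.max `| pq.2%:~R * x.1 + pq.1.1%:~R - y.1 |
              `| pq.2%:~R * x.2 + pq.1.2%:~R - y.2 |
        < psi `|pq.2|%N].
  apply/seteqP; split => pq; rewrite /U /= gt_max.
    case: ifP => // _; rewrite /= !mul0r addr0 add0r !addrA => -[-> ->].
    by split.
  by move=> [-> /andP[]]; rewrite /= !mul0r addr0 add0r !addrA => -> ->.
by apply/seteqP; split => x; rewrite /A12 /= UE; tauto.
Qed.

(* For [t = j x.1 + n x.2 - y], the integer [p = - floor t] gives [t + p = frac t]. *)
Lemma limsup_strips_sub_A21 (psi delta : nat -> R) (y : R) (x : TR * TR) :
  (forall n, delta n <= psi n) -> 0 <= x.1 < 1 -> 0 <= x.2 < 1 ->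
  limsup_sets id (fun n j => strip j n y (delta n)) x -> A21 psi y x.
Proof.
move=> dpsi /andP[x0 x1] /andP[y0 y1] lim.
split; first by rewrite x0 ltW.
split; first by rewrite y0 ltW.
(* If the pairs were finitely many, their last entries would be bounded by some [K], against
   [n > K]. Starting from [K.+1] also ensures that [(j, n)] is nonzero. *)
pose f (pq : int * (int * int)) := `|pq.2.2|%N.
move=> /(@finite_set_bounded _ _ f)[K HK].
have [n [j [Kn jn h]]] := lim K.+1.
pose p := - Num.floor (j%:R * x.1 + n%:R * x.2 - y : R).
have := HK (p, (j%:Z, n%:Z)); rewrite /f /= ltnNge (ltnW Kn) /= => H.
suff : false by [].
apply: H; split.
  by apply/eqP => -[_ n0]; move: Kn; rewrite n0.
(* As [j < n], the max norm of [(j, n)] is [n]. *)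
rewrite (maxn_idPr (ltnW jn)) -!pmulrn.
have -> : j%:R * x.1 + n%:R * x.2 + p%:~R - y = frac (j%:R * x.1 + n%:R * x.2 - y : R).
  by rewrite /frac /p rmorphN; ring.
by rewrite ger0_norm ?frac_ge0 //; apply: lt_le_trans (dpsi n); exact: h.
Qed.

Lemma limsup_boxes_sub_A12 (psi delta : nat -> R) (y : R * R) (x : TR * TR) :
  (forall n, delta n <= psi n) -> 0 <= x.1 < 1 -> 0 <= x.2 < 1 ->
  limsup_sets (fun=> 1%N) (fun n _ => box n y (delta n)) x -> A12 psi y x.
Proof.
move=> dpsi /andP[x0 x1] /andP[y0 y1] lim.
split; first by rewrite x0 ltW.
split; first by rewrite y0 ltW.
pose f (pq : (int * int) * int) := `|pq.2|%N.
move=> /(@finite_set_bounded _ _ f)[K HK].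
have [n [j [Kn _ [h1 h2]]]] := lim K.+1.
pose p1 := - Num.floor (n%:R * x.1 - y.1 : R).
pose p2 := - Num.floor (n%:R * x.2 - y.2 : R).
have := HK ((p1, p2), n%:Z); rewrite /f /= ltnNge (ltnW Kn) /= => H.
suff : false by [].
apply: H; split.
  by apply/eqP => -[n0]; move: Kn; rewrite n0.
rewrite -!pmulrn gt_max.
have -> : n%:R * x.1 + p1%:~R - y.1 = frac (n%:R * x.1 - y.1 : R).
  by rewrite /frac /p1 rmorphN; ring.
have -> : n%:R * x.2 + p2%:~R - y.2 = frac (n%:R * x.2 - y.2 : R).
  by rewrite /frac /p2 rmorphN; ring.
move: h1 h2; rewrite /strip /= !mul0r addr0 add0r => h1 h2.
by rewrite !ger0_norm ?frac_ge0 //; apply/andP; split; apply: lt_le_trans (dpsi n).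
Qed.

(** * Truncation of the radii *)

Section Truncation.
Variables (psi : nat -> R).
Hypothesis psi0 : forall q, 0 <= psi q.

Definition trunc1 (n : nat) : R := Num.min (psi n) 1.

Lemma trunc1_itv n : 0 <= trunc1 n <= 1.
Proof. by rewrite /trunc1 le_min psi0 ler01 ge_min lexx orbT. Qed.

Lemma trunc1_le n : trunc1 n <= psi n.
Proof. by rewrite /trunc1 ge_min lexx. Qed.

(** In the first case divergence passes to the truncated radii. In the second, infinitely many
    strips and boxes are the whole torus, and so is the limsup set. *)
Lemma trunc1_cases :
  (exists n0, forall n, (n0 <= n)%N -> trunc1 n = psi n) \/
  (forall n0, exists n, (n0 <= n)%N /\ trunc1 n = 1).
Proof.
have [h|h] := pselect (exists n0, forall n, (n0 <= n)%N -> psi n <= 1).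
  by left; have [n0 H] := h; exists n0 => n /H; rewrite /trunc1 => /min_idPl.
right => n0; apply: contrapT => H; apply: h; exists n0 => n n0n.
rewrite leNgt; apply/negP => psin; apply: H; exists n; split => //.
by rewrite /trunc1; apply/min_idPr/ltW.
Qed.

End Truncation.

(** * Full probability of the truncated limsup sets *)

Lemma unif2_limsup_strips (eps : R) (psi : nat -> R) (y : R) :
  0 < eps -> (forall q, 0 <= psi q) ->
  (\sum_(1 <= q <oo)
     ((((totient q)%:R / q%:R) `^ (1 + eps)) * q%:R * psi q)%:E = +oo)%E ->
  unif2 R (limsup_sets id (fun n j => strip j n y (trunc1 psi n))) = 1%E.
Proof.
move=> e0 psi0 div; have d01 := trunc1_itv _ psi0.
pose w n : R := (totient n)%:R / n%:R.
have w0 n : 0 <= w n by rewrite divr_ge0.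
pose E n j : set (TR * TR) := strip j n y (trunc1 psi n).
have prE0 n j : (0 < n)%N -> pr (unif2 R) (E n j) = trunc1 psi n.
  by move=> n0; exact: pr_strip_b.
have sumE n : (0 < n)%N ->
    \sum_(j < n) pr (unif2 R) (E n j) = n%:R * trunc1 psi n.
  move=> n0; rewrite (eq_bigr (fun=> trunc1 psi n)) => [|j _]; last exact: prE0.
  by rewrite sumr_const card_ord mulr_natl.
have blockE n : block (unif2 R) id w E n = w n * (n%:R * trunc1 psi n).
  have [->|n0] := posnP n; first by rewrite /block /w invr0 mulr0 !mul0r.
  by rewrite /block sumE.
have [[n0 trE]|big] := trunc1_cases psi; last first.
  rewrite (_ : limsup_sets _ _ = setT) ?probability_setT //.
  (* Going to [K.+1] makes [n] positive, so that [j = 0] is an admissible index. *)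
  apply/seteqP; split => x // _ K; have [n [Kn n1]] := big K.+1.
  exists n, 0%N; split; [exact: ltnW|exact: leq_ltn_trans Kn|].
  by rewrite /strip n1 /=; exact: frac_lt1.
apply: (unif2_limsup_sets R id w E 1) => //.
- by move=> n j; exact: measurable_strip.
- move=> a; have := unbounded_sum R
    (fun q => ((totient q)%:R / q%:R) `^ (1 + eps) * q%:R * psi q)
    (fun q => block (unif2 R) id w E q) n0 _ _ _ div a; apply.
  + by move=> n; rewrite !mulr_ge0 ?powR_ge0.
  + by move=> n; apply: block_ge0.
  + move=> n /trE trn; rewrite blockE trn -mulrA ler_wpM2r ?mulr_ge0 //.
    exact: weight_powR_le.
- move=> n k /andP[k0 kn]; have n1 := leq_trans k0 kn.
  have nr : (0 : R) < n%:R by rewrite ltr0n.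
  set g := gcdn n k.
  (* Each of the [n k] pairs of strips contributes at most the product of the radii, plus, if
     parallel, [g / n * trunc1 psi n]; by [count_parallel] there are at most [g] parallel pairs. *)
  apply: le_trans (_ : w n * w k * (n%:R * k%:R * (trunc1 psi n * trunc1 psi k) +
      g%:R * (g%:R / n%:R * trunc1 psi n)) <= _).
    rewrite ler_wpM2l ?mulr_ge0 //.
    apply: le_trans (_ : \sum_(i < n) \sum_(j < k) (trunc1 psi n * trunc1 psi k +
        (n * j == i * k)%N%:R * (g%:R / n%:R * trunc1 psi n)) <= _).
      apply: ler_sum => i _; apply: ler_sum => j _; rewrite /E.
      have [ij|ij] := boolP (n * j == i * k)%N.
        rewrite mul1r; apply: le_trans (pr_stripI_le _ _ _ _ _ _ _ _ _ n1 (d01 n) (d01 k)) _.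
        by rewrite -/g mulrDl [_ * trunc1 psi k]mulrC.
      by rewrite mul0r addr0 pr_stripI_indep // mulrC.
    under eq_bigr => i _ do rewrite big_split /= sumr_const card_ord -mulr_suml -natr_sum.
    rewrite big_split /= sumr_const card_ord -mulr_suml -natr_sum.
    apply: lerD.
      by rewrite -mulrnA -[leLHS]mulr_natl natrM [k%:R * n%:R]mulrC.
    rewrite ler_wpM2r ?ler_nat ?count_parallel //.
    by case/andP: (d01 n) => ? _; rewrite mulr_ge0 // divr_ge0.
  rewrite !blockE.
  have b0 : 0 <= w n * (n%:R * trunc1 psi n) * (w k * (k%:R * trunc1 psi k)).
    by case/andP: (d01 n) => ? _; case/andP: (d01 k) => ? _; rewrite !mulr_ge0.
  have -> : w n * w k * (n%:R * k%:R * (trunc1 psi n * trunc1 psi k) +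
      g%:R * (g%:R / n%:R * trunc1 psi n)) =
      w n * (n%:R * trunc1 psi n) * (w k * (k%:R * trunc1 psi k)) +
      w n * (n%:R * trunc1 psi n) * (w k * g%:R ^+ 2 / n%:R ^+ 2).
    by field; rewrite lt0r_neq0.
  have c0 : 0 <= w n * (n%:R * trunc1 psi n) * (w k * g%:R ^+ 2 / n%:R ^+ 2).
    by case/andP: (d01 n) => ? _; rewrite !mulr_ge0 // invr_ge0 exprn_ge0.
  lra.
- move=> n a a' d d' n1 h h'; rewrite mulr_sumr -sumrB mulr_sumr.
  apply: le_trans (ler_norm_sum _ _ _) _; apply: ler_sum => j _.
  by rewrite prE0 // mul1r; exact: strip_rectangle_discrepancy.
Qed.

Lemma unif2_limsup_boxes (eps : R) (psi : nat -> R) (y : R * R) :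
  0 < eps -> (forall q, 0 <= psi q) ->
  (\sum_(1 <= q <oo)
     ((((totient q)%:R / q%:R) `^ (1 + eps)) * psi q ^+ 2)%:E = +oo)%E ->
  unif2 R (limsup_sets (fun=> 1%N) (fun n _ => box n y (trunc1 psi n))) = 1%E.
Proof.
move=> e0 psi0 div; have d01 := trunc1_itv _ psi0.
pose w n : R := (totient n)%:R / n%:R.
have w0 n : 0 <= w n by rewrite divr_ge0.
pose E n (_ : nat) : set (TR * TR) := box n y (trunc1 psi n).
have blockE n : block (unif2 R) (fun=> 1%N) w E n = w n * trunc1 psi n ^+ 2.
  have [->|n0] := posnP n; first by rewrite /block /w invr0 mulr0 !mul0r.
  by rewrite /block big_ord1 pr_box.
have [[n0 trE]|big] := trunc1_cases psi; last first.
  rewrite (_ : limsup_sets _ _ = setT) ?probability_setT //.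
  apply/seteqP; split => x // _ K; have [n [Kn n1]] := big K.
  exists n, 0%N; split => //.
  by rewrite /box /strip n1 /=; split; exact: frac_lt1.
apply: (unif2_limsup_sets R (fun=> 1%N) w E 3) => //.
- by move=> n j; exact: measurable_box.
- move=> a; have := unbounded_sum R
    (fun q => ((totient q)%:R / q%:R) `^ (1 + eps) * psi q ^+ 2)
    (fun q => block (unif2 R) (fun=> 1%N) w E q) n0 _ _ _ div a; apply.
  + by move=> n; rewrite mulr_ge0 ?powR_ge0 ?sqr_ge0.
  + by move=> n; apply: block_ge0.
  + move=> n /trE trn; rewrite blockE trn ler_wpM2r ?sqr_ge0 //.
    exact: weight_powR_le.
- move=> n k /andP[k0 kn]; have n1 := leq_trans k0 kn.
  have nr : (0 : R) < n%:R by rewrite ltr0n.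
  rewrite !big_ord1 !blockE; set g := gcdn n k.
  apply: le_trans (_ : w n * w k *
    ((trunc1 psi k + g%:R / n%:R) * trunc1 psi n) ^+ 2 <= _).
    by rewrite ler_wpM2l ?mulr_ge0 //; exact: pr_boxI_le.
  (* This is [(u + v)^2 <= 2 u^2 + 2 v^2], with defect [(u - v)^2]. *)
  rewrite -subr_ge0.
  have -> : 2 * (w n * trunc1 psi n ^+ 2 * (w k * trunc1 psi k ^+ 2)) +
     2 * (w n * trunc1 psi n ^+ 2) * (w k * g%:R ^+ 2 / n%:R ^+ 2) -
     w n * w k * ((trunc1 psi k + g%:R / n%:R) * trunc1 psi n) ^+ 2 =
     w n * w k * ((trunc1 psi k - g%:R / n%:R) * trunc1 psi n) ^+ 2.
    by field; rewrite lt0r_neq0.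
  by apply: mulr_ge0; [exact: mulr_ge0|exact: sqr_ge0].
- move=> n a a' d d' n1 h h'; rewrite !big_ord1 /E pr_box //.
  exact: box_rectangle_discrepancy.
Qed.

End ApproximableSets.

Theorem theorem3 (R : realType) (eps : R) (heps : 0 < eps) :
  (forall (psi : nat -> R), (forall q, 0 <= psi q) -> forall y : R,
     (\sum_(1 <= q <oo)
        ((((totient q)%:R / q%:R) `^ (1 + eps)) * q%:R * psi q)%:E = +oo)%E ->
     ((@lebesgue_measure R \x @lebesgue_measure R) (A21 psi y) = 1)%E)
  /\
  (forall (psi : nat -> R), (forall q, 0 <= psi q) -> forall y : R * R,
     (\sum_(1 <= q <oo)
        ((((totient q)%:R / q%:R) `^ (1 + eps)) * psi q ^+ 2)%:E = +oo)%E ->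
     ((@lebesgue_measure R \x @lebesgue_measure R) (A12 psi y) = 1)%E).
Proof.
split => psi psi0 y div.
- apply: lebesgue2_full (measurable_A21 _ _ _) _ (unif2_limsup_strips _ _ _ _ heps psi0 div) _ _.
  + by apply: measurable_limsup_sets => n j; exact: measurable_strip.
  + by move=> x [h1 [h2 _]].
  + by move=> x x1 x2; apply: limsup_strips_sub_A21 => //; exact: trunc1_le.
- apply: lebesgue2_full (measurable_A12 _ _ _) _ (unif2_limsup_boxes _ _ _ _ heps psi0 div) _ _.
  + by apply: measurable_limsup_sets => n j; exact: measurable_box.
  + by move=> x [h1 [h2 _]].
  + by move=> x x1 x2; apply: limsup_boxes_sub_A12 => //; exact: trunc1_le.
Qed.
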